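(* Let $\mathcal Z$ have independent entries $\mathcal Z_{abc}\sim N(0,\sigma_{abc}^2)$ and let $\Theta=\Theta(\lambda,\kappa,\mu_0,\sigma,\sigma_{\min})$ be the parameter space defined in the context. Suppose that $0<\alpha<1/2$, that $\mu_0>2$, and that $r_{\max}\le Cr_{\min}$ and $p_l\le Cp_{\min}$ for each mode $l$. Then there is some constant $c>0$ such that $$\inf_{\mathrm{C.I.}_{ijk}^\alpha(\mathcal Z,\mathcal T)\in\mathcal I_\alpha(\Theta,\{i,j,k\})}\ \sup_{\mathcal T\in\Theta}\ \mathbb E_{\mathcal T}L\big(\mathrm{C.I.}_{ijk}^\alpha(\mathcal Z,\mathcal T)\big)\ \ge\ c\,\sigma_{\min}\sqrt{\|e_{(j-1)p_3+k}^\top\mathbf V_1\|^2+\|e_{(k-1)p_1+i}^\top\mathbf V_2\|^2+\|e_{(i-1)p_2+j}^\top\mathbf V_3\|^2},$$ where, on the right-hand side, $\mathbf V_1,\mathbf V_2,\mathbf V_3$ are the matrices of right singular vectors of the three matricizations of any given signal tensor in $\Theta$.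
   Context: One observes $\widetilde{\mathcal T}=\mathcal T+\mathcal Z\in\mathbb R^{p_1\times p_2\times p_3}$, with $\mathbb P_{\mathcal T},\mathbb E_{\mathcal T}$ the corresponding probability and expectation when the signal is $\mathcal T$; $p_k\asymp p$, $r_k\asymp r$ for all $k$ (equal up to universal constants), and $\sigma\le C\sigma_{\min}$. $p_{\max},p_{\min},r_{\max},r_{\min}$ are maxima/minima over the three modes. $\times_k$ denotes the mode-$k$ product, $\|\mathbf M\|_{2,\infty}$ the maximum Euclidean norm of a row, $e_m$ standard basis vectors. With mode indices modulo 3, the mode-$k$ matricization $\mathcal M_k(\mathcal T)$ has $\mathcal T_{i_1i_2i_3}$ in row $i_k$ and column $(i_{k+1}-1)p_{k+2}+i_{k+2}$, and its rank-$r_k$ SVD is written $\mathbf U_k\mathbf\Lambda_k\mathbf V_k^\top$. For a core tensor $\mathcal S$, $\lambda_{\min}(\mathcal S)$ and $\lambda_{\max}(\mathcal S)$ denote the smallest and largest singular values over its matricizations. Parameter space: $\Theta(\lambda,\kappa,\mu_0,\sigma,\sigma_{\min})$ is the set of $\mathcal T\in\mathbb R^{p_1\times p_2\times p_3}$ such that $\mathcal T=\mathcal S\times_1\mathbf U_1\times_2\mathbf U_2\times_3\mathbf U_3$ with $\mathcal S\in\mathbb R^{r_1\times r_2\times r_3}$; $\mathbf U_k\in\mathbb R^{p_k\times r_k}$, $\mathbf U_k^\top\mathbf U_k=\mathbf I_{r_k}$, $\|\mathbf U_k\|_{2,\infty}\le\mu_0\sqrt{r_k/p_k}$; $\lambda\le\lambda_{\min}(\mathcal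 S)\le\lambda_{\max}(\mathcal S)\le\kappa\lambda$; where moreover $\lambda/\sigma\ge C_0\kappa r_{\max}\sqrt{p_{\max}}$ ($C_0$ a constant), $\sigma_{\min}\le\sigma_{abc}\le\sigma$, $\kappa\le p_{\min}^{1/4}$, $r_{\max}\le p_{\min}^{1/2}$. Confidence intervals: $\mathcal I_\alpha(\Theta,\{i,j,k\})$ is the set of all (data-dependent) intervals $\mathrm{C.I.}_{ijk}^\alpha(\mathcal Z,\mathcal T)=[l,u]$ with $\inf_{\mathcal T\in\Theta}\mathbb P_{\mathcal T}(l\le\mathcal T_{ijk}\le u)\ge1-\alpha$. The length is $L([l,u])=|u-l|$.
   Formalization: The case p_1 = p_2 = p_3 = 1 is excluded: there the parameter space is {λ, −λ}, and for large λ/σ the zero-length interval at sign(observation)·λ has the required coverage, so the stated bound fails. *)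

(* Defs.v *)
From HB Require Import structures.
From mathcomp Require Import all_boot all_order all_algebra.
From mathcomp Require Import all_classical all_reals all_analysis.

Set Implicit Arguments.
Unset Strict Implicit.
Unset Printing Implicit Defensive.

Import Order.TTheory GRing.Theory Num.Theory.
Import numFieldNormedType.Exports.

Local Open Scope classical_set_scope.
Local Open Scope ring_scope.

Definition min3 (a b c : nat) : nat := minn a (minn b c).
Definition max3 (a b c : nat) : nat := maxn a (maxn b c).

Definition tensor (R : realType) (p1 p2 p3 : nat) : Type :=
  'I_p1 -> 'I_p2 -> 'I_p3 -> R.

Section Tensors.
Context {R : realType}.

Definition mode_prod1 {r1 r2 r3 p} (S : tensor R r1 r2 r3) (U : 'M[R]_(p, r1)) :
    tensor R p r2 r3 :=
  fun i b c => \sum_a S a b c * U i a.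

Definition mode_prod2 {r1 r2 r3 p} (S : tensor R r1 r2 r3) (U : 'M[R]_(p, r2)) :
    tensor R r1 p r3 :=
  fun a j c => \sum_b S a b c * U j b.

Definition mode_prod3 {r1 r2 r3 p} (S : tensor R r1 r2 r3) (U : 'M[R]_(p, r3)) :
    tensor R r1 r2 p :=
  fun a b k => \sum_c S a b c * U k c.

(* [mxvec] reads a matrix row by row, so that, counting from 0, the column of
   [matricization1 T] with index [mxvec_index j k] is column j * p3 + k;
   likewise k * p1 + i in mode 2 and i * p2 + j in mode 3. *)
Definition matricization1 {p1 p2 p3} (T : tensor R p1 p2 p3) :
    'M[R]_(p1, p2 * p3) :=
  \matrix_(i < p1) mxvec (\matrix_(j < p2, k < p3) T i j k).

Definition matricization2 {p1 p2 p3} (T : tensor R p1 p2 p3) :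
    'M[R]_(p2, p3 * p1) :=
  \matrix_(j < p2) mxvec (\matrix_(k < p3, i < p1) T i j k).

Definition matricization3 {p1 p2 p3} (T : tensor R p1 p2 p3) :
    'M[R]_(p3, p1 * p2) :=
  \matrix_(k < p3) mxvec (\matrix_(i < p1, j < p2) T i j k).

Definition enorm {n} (v : 'rV[R]_n) : R := Num.sqrt (\sum_j v 0 j ^+ 2).

Definition norm2inf {m n} (M : 'M[R]_(m, n)) : R :=
  \big[Num.max/0]_(i < m) enorm (row i M).

(* An m x n matrix is given m singular values, the square roots of the
   eigenvalues of M M^T. For m <= n this is the usual notion; for m > n the
   value 0 is included, so that for a core tensor the least singular value in
   mode k is the r_k-th one, and is positive only if that matricization has
   rank r_k. *)
Definition singular_values {m n} (M : 'M[R]_(m, n)) : set R :=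
  [set s | 0 <= s /\ eigenvalue (M *m M^T) (s ^+ 2)].

Definition tensor_singular_values {r1 r2 r3} (S : tensor R r1 r2 r3) : set R :=
  singular_values (matricization1 S) `|` singular_values (matricization2 S)
    `|` singular_values (matricization3 S).

Definition lambda_min {r1 r2 r3} (S : tensor R r1 r2 r3) : R :=
  inf (tensor_singular_values S).

Definition lambda_max {r1 r2 r3} (S : tensor R r1 r2 r3) : R :=
  sup (tensor_singular_values S).

Definition rank_svd {m n r} (M : 'M[R]_(m, n))
    (U : 'M[R]_(m, r)) (L : 'rV[R]_r) (V : 'M[R]_(n, r)) : Prop :=
  [/\ U^T *m U = 1%:M, V^T *m V = 1%:M, forall a, 0 <= L 0 a
    & M = U *m diag_mx L *m V^T].

Definition incoherent {p r} (mu0 : R) (U : 'M[R]_(p, r)) : Prop :=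
  U^T *m U = 1%:M /\ norm2inf U <= mu0 * Num.sqrt (r%:R / p%:R).

(* [sd a b c] is the standard deviation of the noise in entry (a, b, c). *)
Definition Theta {p1 p2 p3} (r1 r2 r3 : nat) (C0 : R) (sd : tensor R p1 p2 p3)
    (lambda kappa mu0 sigma sigma_min : R) : set (tensor R p1 p2 p3) :=
  [set T |
    (exists (S : tensor R r1 r2 r3) (U1 : 'M[R]_(p1, r1)) (U2 : 'M[R]_(p2, r2))
        (U3 : 'M[R]_(p3, r3)),
      [/\ T = mode_prod3 (mode_prod2 (mode_prod1 S U1) U2) U3,
          [/\ incoherent mu0 U1, incoherent mu0 U2 & incoherent mu0 U3]
        & lambda <= lambda_min S /\ lambda_min S <= lambda_max S /\
          lambda_max S <= kappa * lambda]) /\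
    [/\ C0 * kappa * (max3 r1 r2 r3)%:R * Num.sqrt (max3 p1 p2 p3)%:R
          <= lambda / sigma,
        forall a b c, sigma_min <= sd a b c <= sigma,
        kappa <= ((min3 p1 p2 p3)%:R : R) `^ 4^-1
      & (max3 r1 r2 r3)%:R <= ((min3 p1 p2 p3)%:R : R) `^ 2^-1]].

Definition cylinders {p1 p2 p3} : set (set (tensor R p1 p2 p3)) :=
  [set A | exists (a : 'I_p1) (b : 'I_p2) (c : 'I_p3) (B : set R),
    measurable B /\ A = [set X | B (X a b c)]].

(* A data-dependent interval sends the observed tensor to its pair of
   endpoints (l, u). *)
Definition measurable_interval {p1 p2 p3} (ci : tensor R p1 p2 p3 -> R * R) :
    Prop :=
  measurable_fun setT (ci : g_sigma_algebraType (@cylinders p1 p2 p3) -> R * R).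

Definition ci_length (I : R * R) : R := `|I.2 - I.1|.

End Tensors.

Section Probability.
Context {R : realType} {d : measure_display} {Omega : measurableType d}.
Variable P : probability Omega R.

Definition mutually_independent {I : finType} (X : I -> {RV P >-> R}) : Prop :=
  forall (J : {set I}) (B : I -> set R), (forall i, measurable (B i)) ->
    P (\big[setI/setT]_(i in J) (X i @^-1` B i)) =
    (\prod_(i in J) P (X i @^-1` B i))%E.

Definition gaussian_noise {p1 p2 p3} (sd : tensor R p1 p2 p3)
    (Z : 'I_p1 -> 'I_p2 -> 'I_p3 -> {RV P >-> R}) : Prop :=
  mutually_independent
    (fun x : 'I_p1 * 'I_p2 * 'I_p3 => Z x.1.1 x.1.2 x.2) /\
  forall a b c (B : set R), measurable B ->
    distribution P (Z a b c) B = normal_prob 0 (sd a b c) B.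

Context {p1 p2 p3 : nat}.
Variable Z : 'I_p1 -> 'I_p2 -> 'I_p3 -> {RV P >-> R}.

Definition observation (T : tensor R p1 p2 p3) (w : Omega) :
    tensor R p1 p2 p3 :=
  fun a b c => T a b c + Z a b c w.

Definition coverage (ci : tensor R p1 p2 p3 -> R * R) i j k
    (T : tensor R p1 p2 p3) : \bar R :=
  P [set w | (ci (observation T w)).1 <= T i j k <= (ci (observation T w)).2].

Definition expected_length (ci : tensor R p1 p2 p3 -> R * R)
    (T : tensor R p1 p2 p3) : \bar R :=
  ('E_P[fun w => ci_length (ci (observation T w))])%E.

Definition confidence_intervals (Th : set (tensor R p1 p2 p3)) (alpha : R)
    i j k : set (tensor R p1 p2 p3 -> R * R) :=
  [set ci | measurable_interval ci /\
    ((1 - alpha)%:E <= ereal_inf [set coverage ci i j k T | T in Th])%E].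

Definition minimax_length (Th : set (tensor R p1 p2 p3)) (alpha : R)
    i j k : \bar R :=
  ereal_inf [set ereal_sup [set expected_length ci T | T in Th]
            | ci in confidence_intervals Th alpha i j k].

End Probability.

(* Main.v *)
Require Import Defs.
From HB Require Import structures.
From mathcomp Require Import all_boot all_order all_algebra.
From mathcomp Require Import all_classical all_reals all_analysis.
From mathcomp Require Import measurable_realfun.
From mathcomp Require Import zify ring lra.

Set Implicit Arguments.
Unset Strict Implicit.
Unset Printing Implicit Defensive.

Import Order.TTheory GRing.Theory Num.Theory.
Import numFieldNormedType.Exports.

Local Open Scope classical_set_scope.
Local Open Scope ring_scope.

(** The bound is a two-point argument. If [T0] and [T1] both belong to the
    parameter space and their observations are hard to tell apart, then an
    interval that covers the entry [(i, j, k)] of each with probability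
    [1 - alpha] contains both entries at once, under [T0], with probability
    bounded below; so its expected length there is at least a constant times
    the gap between the two entries ([two_point_length]). For Gaussian noise
    the likelihood ratio of the two observations has second moment
    [exp (sum of (T1 - T0)^2 / sd^2)], so that [T0] and [T1] are hard to tell
    apart as soon as their Euclidean distance is at most a small multiple
    [tau] of [sigma_min]. As [alpha] may be close to [1/2], the comparison has
    to be an additive one with an arbitrarily small error
    ([density_le_chi_square]).

    It remains to find such a pair with a gap of order [tau] times the norm of
    row [(j, k)] of [V1]; the other two modes follow by rotating the indices.
    The core and the factors of modes 2 and 3 of the given tensor are kept, so
    that all conditions on singular values hold automatically and only the
    mode-1 factor has to be watched for incoherence. Writing the mode-1
    unfolding as [U diag(L) V^T] and replacing [U] by another orthonormal frame
    [G] stays in the family, because [U] and the mode-1 factor differ by an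
    orthogonal matrix ([align_svd]). For [T0] the frame is spread evenly over
    all coordinates except [i], where it vanishes ([zero_row_frame]); its rows
    are within the incoherence bound with constant 2, whatever the original
    factor was. For [T1] one direction [y] of that frame is turned slightly
    towards the coordinate vector [e_i] ([rotate_frame]). With [v] the row
    [(j, k)] of [V], the choice of [y] proportional to [v / L] makes the whole
    perturbation proportional to [V v] inside its only large row, hence its
    [(i, j, k)] entry is the fraction [|v|] of its norm
    ([perturb_left_factor]). The angle is of order [tau / lambda], which the
    signal-to-noise condition keeps below the incoherence bound.

    Turning a frame needs a mode of length at least two. If some mode has
    length one then all ranks are one, all lengths are bounded, and the
    argument is run from a rank-one tensor with constant entries in a mode of
    length at least two, where the row norm is bounded below
    ([separated_flat_mode1]). *)

(** * Expectations of products of independent variables *)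

Section WeightedTransfer.
Local Open Scope ereal_scope.
Context {R : realType} {dY : measure_display} {Y : measurableType dY}.
Import HBNNSimple.

Section OneSide.
Context {d : measure_display} {T : measurableType d}.
Variables (mu : {measure set T -> \bar R}) (K : T -> R) (X : T -> Y).
Hypotheses (mK : measurable_fun setT K) (K0 : forall t, (0 <= K t)%R).
Hypothesis (mX : measurable_fun setT X).

Let mass (B : set Y) := \int[mu]_t (K t * \1_B (X t))%:E.

Lemma measurable_weighted (h : Y -> R) : measurable_fun setT h ->
  measurable_fun setT (fun t => (K t * h (X t))%:E).
Proof.
move=> mh; apply/measurable_EFinP.
exact: (measurable_funM mK (measurableT_comp mh mX)).
Qed.

Lemma weighted_integral_simple (f : {nnsfun Y >-> R}) :
  \int[mu]_t (K t * f (X t))%:E =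
  \sum_(r \in range f) (r%:E * mass (f @^-1` [set r])).
Proof.
under eq_integral do rewrite fimfunE mulr_fsumr -fsumEFin//.
rewrite ge0_integral_fsum//; last 2 first.
- move=> r; apply: (measurable_weighted (h := fun y => r * \1_(f @^-1` [set r]) y)%R).
  by apply: measurable_funM => //; exact: measurable_indic.
- move=> r t _; rewrite lee_fin mulr_ge0//.
  by have := nnfun_muleindic_ge0 f r (X t); rewrite lee_fin.
apply: eq_fsbigr => r; rewrite inE/= => -[y _ <-].
under eq_integral do rewrite mulrCA EFinM.
rewrite ge0_integralZl_EFin//.
- by move=> t _; rewrite lee_fin mulr_ge0.
- exact: measurable_weighted.
Qed.

Lemma weighted_integral_lim (h : Y -> R) (mh : measurable_fun setT h)
    (h0 : forall y, (0 <= h y)%R) :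
  \int[mu]_t (K t * h (X t))%:E =
  limn (fun n => \int[mu]_t (K t *
     nnsfun_approx measurableT ((measurable_EFinP setT h).2 mh) n (X t))%:E).
Proof.
set f := nnsfun_approx _ _.
rewrite -monotone_convergence//.
- apply: eq_integral => t _; apply/esym/cvg_lim => //.
  under eq_fun do rewrite EFinM.
  rewrite EFinM; apply: cvgeZl => //.
  by apply: (cvg_nnsfun_approx measurableT (f := EFin \o h)) => // y _; rewrite lee_fin.
- by move=> n; apply: measurable_weighted.
- by move=> n t _; rewrite lee_fin mulr_ge0.
- move=> t _ m n mn; rewrite lee_fin ler_wpM2l//.
  exact/lefP/nd_nnsfun_approx.
Qed.

End OneSide.

(** An identity between weighted integrals passes from indicators to all
    nonnegative functions of [X1] and [X2]. The weights serve twice: they carry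
    the other factors of a product of independent variables, and the density
    of a law with respect to the Lebesgue measure. *)
Lemma eq_weighted_integral {d1 d2 : measure_display}
    {T1 : measurableType d1} {T2 : measurableType d2}
    (mu1 : {measure set T1 -> \bar R}) (mu2 : {measure set T2 -> \bar R})
    (K1 : T1 -> R) (K2 : T2 -> R) (X1 : T1 -> Y) (X2 : T2 -> Y) (h : Y -> R) :
  measurable_fun setT K1 -> (forall t, 0 <= K1 t)%R -> measurable_fun setT X1 ->
  measurable_fun setT K2 -> (forall t, 0 <= K2 t)%R -> measurable_fun setT X2 ->
  measurable_fun setT h -> (forall y, 0 <= h y)%R ->
  (forall B, measurable B -> \int[mu1]_t (K1 t * \1_B (X1 t))%:E =
                             \int[mu2]_t (K2 t * \1_B (X2 t))%:E) ->
  \int[mu1]_t (K1 t * h (X1 t))%:E = \int[mu2]_t (K2 t * h (X2 t))%:E.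
Proof.
move=> mK1 K10 mX1 mK2 K20 mX2 mh h0 eqB.
rewrite (weighted_integral_lim mu1 mK1 K10 mX1 mh h0).
rewrite (weighted_integral_lim mu2 mK2 K20 mX2 mh h0).
apply/congr_lim/funext => n; rewrite !weighted_integral_simple//.
by apply: eq_fsbigr => r _; rewrite eqB.
Qed.

End WeightedTransfer.

Section ProductExpectation.
Local Open Scope ereal_scope.
Context {R : realType} {d : measure_display} {Omega : measurableType d}.
Variables (P : probability Omega R) (I : finType) (X : I -> {RV P >-> R}).
Hypothesis indep : mutually_independent X.

Lemma prod_indic_preimage (B : I -> set R) (s : seq I) (w : Omega) :
  (\prod_(i <- s) \1_(B i) (X i w) =
   \1_(\big[setI/setT]_(i <- s) (X i @^-1` B i)) w :> R)%R.
Proof.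
elim: s => [|i s IH]; first by rewrite !big_nil indicT.
by rewrite !big_cons indicI /= IH.
Qed.

(** Induction on the number of factors that are not indicators: with none
    left, this is the definition of independence, and each step frees one
    factor through [eq_weighted_integral]. *)
Lemma expectation_prod (g : I -> R -> R) (e : I -> R) :
  (forall i, measurable_fun setT (g i)) -> (forall i y, 0 <= g i y)%R ->
  (forall i, \int[P]_w (g i (X i w))%:E = (e i)%:E) ->
  \int[P]_w (\prod_i g i (X i w))%:E = (\prod_i e i)%:E.
Proof.
suff gen (s : seq I) : forall (g : I -> R -> R) (e : I -> R),
  (forall i, measurable_fun setT (g i)) -> (forall i y, 0 <= g i y)%R ->
  (forall i, \int[P]_w (g i (X i w))%:E = (e i)%:E) ->
  (forall i, i \notin s -> exists2 B, measurable B & g i = \1_B) ->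
  \int[P]_w (\prod_i g i (X i w))%:E = (\prod_i e i)%:E.
  by move=> mg g0 eg; apply: (gen (enum I)) => // i; rewrite mem_enum.
elim: s => [|i0 s IH] {}g {}e mg g0 eg gs.
  have /choice[B BP] : forall i, exists B, measurable B /\ g i = \1_B.
    by move=> i; have [B mB ->] := gs i isT; exists B.
  have mB i : measurable (X i @^-1` B i).
    by apply: measurable_funPTI => //; exact: (BP i).1.
  have mI : measurable (\big[setI/setT]_i (X i @^-1` B i)).
    by apply: bigsetI_measurable.
  transitivity (\int[P]_w (\1_(\big[setI/setT]_i (X i @^-1` B i)) w)%:E).
    apply: eq_integral => w _; rewrite -prod_indic_preimage.
    by congr (_%:E); apply: eq_bigr => i _; rewrite (BP i).2.
  rewrite integral_indic// setIT.
  have := indep [set: I]%SET (fun i => (BP i).1).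
  under eq_bigl do rewrite finset.in_setT.
  under [in RHS]eq_bigl do rewrite finset.in_setT.
  move=> H; transitivity (\prod_i P (X i @^-1` B i)); first exact: H.
  rewrite -prodEFin; apply: eq_bigr => i _.
  rewrite -eg (BP i).2.
  transitivity (\int[P]_w (\1_(X i @^-1` B i) w)%:E); last by [].
  by rewrite integral_indic// setIT.
have e0 i : (0 <= e i)%R.
  by rewrite -lee_fin -eg integral_ge0// => w _; rewrite lee_fin.
pose K w := (\prod_(i | i != i0) g i (X i w))%R.
pose k := (\prod_(i | i != i0) e i)%R.
have K0 w : (0 <= K w)%R by apply: prodr_ge0.
have k0 : (0 <= k)%R by apply: prodr_ge0.
have mgX i : measurable_fun setT (fun w => g i (X i w)).
  exact: measurableT_comp.
have mK : measurable_fun setT K.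
  by rewrite /K; under eq_fun do rewrite -big_filter; apply: measurable_prod.
transitivity (\int[P]_w (K w * g i0 (X i0 w))%:E).
  by apply: eq_integral => w _; rewrite (bigD1 i0)//= mulrC.
transitivity (\int[P]_w (k * g i0 (X i0 w))%:E); last first.
  under eq_integral do rewrite EFinM.
  rewrite ge0_integralZl_EFin//; last 2 first.
  - by move=> w _; rewrite lee_fin.
  - exact/measurable_EFinP.
  by rewrite eg -EFinM [in RHS](bigD1 i0)//= mulrC.
apply: (eq_weighted_integral (mu1 := P) (mu2 := P) (K1 := K) (K2 := cst k)
  (X1 := X i0) (X2 := X i0) (h := g i0)) => //.
move=> B mB.
pose g' i := if i == i0 then \1_B : R -> R else g i.
pose e' i := if i == i0 then fine (P (X i0 @^-1` B)) else e i.
have mXB : measurable (X i0 @^-1` B) by apply: measurable_funPTI.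
have iB : \int[P]_w (\1_B (X i0 w))%:E = (fine (P (X i0 @^-1` B)))%:E.
  rewrite fineK ?fin_num_measure//.
  transitivity (\int[P]_w (\1_(X i0 @^-1` B) w)%:E); first by [].
  by rewrite integral_indic// setIT.
transitivity (\int[P]_w (\prod_i g' i (X i w))%:E).
  apply: eq_integral => w _; rewrite (bigD1 i0)//= /g' eqxx mulrC.
  by congr (_ * _)%:E; apply: eq_bigr => i /negbTE ->.
rewrite (IH g' e').
- under [in RHS]eq_integral do rewrite EFinM.
  rewrite ge0_integralZl_EFin//; last first.
    by apply/measurable_EFinP; apply: measurableT_comp.
  rewrite iB -EFinM (bigD1 i0)//= /e' eqxx mulrC.
  by congr (_ * _)%:E; apply: eq_bigr => i /negbTE ->.
- by move=> i; rewrite /g'; case: ifP.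
- by move=> i y; rewrite /g'; case: ifP.
- by move=> i; rewrite /g' /e'; case: eqP => [->|_].
- move=> i nis; rewrite /g'; case: eqP => [_|/eqP ni]; first by exists B.
  by apply: gs; rewrite in_cons negb_or ni.
Qed.

End ProductExpectation.

(** * Shifting a Gaussian variable *)

Section GaussianTilt.
Context {R : realType}.
Local Notation leb := (@lebesgue_measure R).

Lemma lebesgue_integral_shift (f : R -> R) (a : R) :
  measurable_fun setT f -> (forall x, 0 <= f x) ->
  (\int[leb]_x (f (x + a))%:E = \int[leb]_x (f x)%:E)%E.
Proof.
move=> mf f0.
have ma : measurable_fun setT (fun x : measurableTypeR R => x + a : measurableTypeR R).
  exact: measurable_funD.
pose mu := pushforward leb (fun x : measurableTypeR R => x + a : measurableTypeR R).
transitivity (\int[mu]_x (f x)%:E)%E.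
  rewrite ge0_integral_pushforward//.
  - exact/measurable_EFinP.
  - by move=> x _; rewrite lee_fin.
apply: eq_measure_integral => A mA _; apply/esym.
apply: lebesgue_measure_unique => // _ [[x y] _ <-] /=.
rewrite /mu /pushforward.
rewrite (_ : _ @^-1` _ = `](x - a), (y - a)]%classic); last first.
  by apply/seteqP; split => z /=; rewrite !in_itv/= ltrBlDr lerBrDr.
rewrite !lebesgue_measure_itv/= !lte_fin ltrD2r; case: ifP => // _.
by rewrite -!EFinB; congr _%:E; lra.
Qed.

(** Likelihood ratio of [N(a, s^2)] with respect to [N(0, s^2)]. *)
Definition tilt (a s x : R) : R := expR (a * x / s ^+ 2 - a ^+ 2 / (2 * s ^+ 2)).

Lemma measurable_tilt a s : measurable_fun setT (tilt a s).
Proof.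
apply: measurableT_comp => //; apply: measurable_funB => //.
by apply: measurable_funM => //; apply: measurable_funM.
Qed.

Lemma tilt_ge0 a s x : 0 <= tilt a s x.
Proof. exact: expR_ge0. Qed.

Lemma normal_pdf_tilt a s x : s != 0 ->
  normal_pdf 0 s x * tilt a s x = normal_pdf a s x.
Proof.
move=> s0; rewrite !normal_pdfE// -mulrA /tilt /normal_fun -expRD.
by congr (_ * expR _); rewrite -mulr_natl; field.
Qed.

(** Completing the square: the squared likelihood ratio moves the mean to
    [2 * a] and leaves the factor that is the chi-square affinity. *)
Lemma normal_pdf_tilt_sqr a s x : s != 0 ->
  normal_pdf 0 s x * tilt a s x ^+ 2 =
  expR (a ^+ 2 / s ^+ 2) * normal_pdf (2 * a) s x.
Proof.
move=> s0; rewrite !normal_pdfE// [RHS]mulrCA -mulrA /tilt /normal_fun.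
rewrite [X in _ * (_ * X) = _]expr2 -!expRD.
by congr (_ * expR _); rewrite -mulr_natl; field.
Qed.

Lemma normal_pdf_shift (a s x : R) : s != 0 ->
  normal_pdf a s (x + a) = normal_pdf 0 s x.
Proof. by move=> s0; rewrite !normal_pdfE// /normal_fun subr0 addrK. Qed.

Context {d : measure_display} {Omega : measurableType d}.
Variables (P : probability Omega R) (X : {RV P >-> R}) (s : R).
Hypothesis s_neq0 : s != 0.
Hypothesis X_normal : forall B, measurable B -> distribution P X B = normal_prob 0 s B.

Lemma expectation_normal (h : R -> R) : measurable_fun setT h -> (forall x, 0 <= h x) ->
  (\int[P]_w (h (X w))%:E = \int[leb]_x (normal_pdf 0 s x * h x)%:E)%E.
Proof.
move=> mh h0.
transitivity (\int[P]_w (1 * h (X w))%:E)%E.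
  by apply: eq_integral => w _; rewrite mul1r.
apply: (eq_weighted_integral (mu1 := P) (mu2 := leb) (K1 := cst 1)
  (K2 := normal_pdf 0 s) (X1 := X) (X2 := idfun) (h := h)) => //.
- exact: measurable_normal_pdf.
- by move=> t; exact: normal_pdf_ge0.
- exact: (@measurable_id _ (measurableTypeR R)).
move=> B mB.
have mXB : measurable (X @^-1` B) by apply: measurable_funPTI.
transitivity (distribution P X B); last rewrite X_normal//.
  under eq_integral do rewrite mul1r.
  transitivity (\int[P]_w (\1_(X @^-1` B) w)%:E)%E; first by [].
  by rewrite integral_indic// setIT.
rewrite /normal_prob [LHS]integral_mkcond; apply: eq_integral => x _.
rewrite /patch indicE; case: ifPn => _; first by rewrite mulr1.
by rewrite mulr0.
Qed.

Lemma expectation_tilt_indic (a t : R) (B : set R) : measurable B ->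
  (\int[P]_w (tilt a s (X w) * \1_B (t + X w))%:E =
   P [set w | B (t + a + X w)%R])%E.
Proof.
move=> mB.
have mD c : measurable_fun setT (fun x : R => c + x) by exact: measurable_funD.
have m1 c : measurable_fun setT (fun x : R => \1_B (c + x) : R).
  by apply: (measurableT_comp (f := \1_B : R -> R)) => //; exact: measurable_indic.
rewrite (expectation_normal (h := fun x => tilt a s x * \1_B (t + x))); last 2 first.
- by apply: measurable_funM => //; exact: measurable_tilt.
- by move=> x; rewrite mulr_ge0// tilt_ge0.
under eq_integral do rewrite mulrA normal_pdf_tilt//.
rewrite -(lebesgue_integral_shift (f := fun x => normal_pdf a s x * \1_B (t + x)) a);
  last 2 first.
- by apply: measurable_funM => //; exact: measurable_normal_pdf.
- by move=> x; rewrite mulr_ge0// normal_pdf_ge0.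
transitivity (\int[P]_w (\1_B (t + a + X w))%:E)%E.
  rewrite (expectation_normal (h := fun x => \1_B (t + a + x)))//.
  by apply: eq_integral => x _; rewrite normal_pdf_shift// -addrA [a + x]addrC.
have mS : measurable ((fun w => t + a + X w) @^-1` B).
  by rewrite -[X in measurable X]setTI; apply: (measurableT_comp (mD (t + a))) => //.
transitivity (\int[P]_w (\1_((fun w => t + a + X w) @^-1` B) w)%:E)%E; first by [].
by rewrite integral_indic// setIT.
Qed.

Lemma expectation_tilt_sqr (a : R) :
  (\int[P]_w (tilt a s (X w) ^+ 2)%:E = (expR (a ^+ 2 / s ^+ 2))%:E)%E.
Proof.
rewrite (expectation_normal (h := fun x => tilt a s x ^+ 2)); last 2 first.
- by apply: measurable_funX; exact: measurable_tilt.
- by move=> x; rewrite sqr_ge0.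
under eq_integral do rewrite normal_pdf_tilt_sqr// EFinM.
rewrite ge0_integralZl_EFin ?expR_ge0//.
- by rewrite integral_normal_pdf mule1.
- by move=> x _; rewrite lee_fin normal_pdf_ge0.
- by apply/measurable_EFinP; exact: measurable_normal_pdf.
Qed.

End GaussianTilt.

(** * Comparing the observations of two tensors *)

Section DensityMeasure.
Context {R : realType} {d : measure_display} {Omega : measurableType d}.
Variables (mu : {measure set Omega -> \bar R}) (q : Omega -> R).
Hypotheses (mq : measurable_fun setT q) (q0 : forall w, 0 <= q w).

(** The two proofs are arguments so that the measure structure can be
    recovered from the term. *)
Definition density_measure (_ : measurable_fun setT q) (_ : forall w, 0 <= q w)
    (A : set Omega) : \bar R := (\int[mu]_(w in A) (q w)%:E)%E.
Local Notation m := (density_measure mq q0).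

Let m0 : m set0 = 0%E.
Proof. by rewrite /density_measure integral_set0. Qed.

Let m_ge0 A : (0 <= m A)%E.
Proof. by apply: integral_ge0 => w _; rewrite lee_fin. Qed.

Let m_sigma_additive : semi_sigma_additive m.
Proof.
move=> /= A mA tA mUA.
rewrite /density_measure ge0_integral_bigcup//.
- apply: is_cvg_ereal_nneg_natsum_cond => n _ _.
  by apply: integral_ge0 => w _; rewrite lee_fin.
- by apply/measurable_EFinP; exact: measurable_funTS.
- by move=> w _; rewrite lee_fin.
Qed.

HB.instance Definition _ := isMeasure.Build _ _ _ m m0 m_ge0 m_sigma_additive.

End DensityMeasure.

Section ChiSquare.
Context {R : realType} {d : measure_display} {Omega : measurableType d}.
Variable P : probability Omega R.

(** Integrate over [A] the inequality [q - 1 <= a + (q - 1)^2 / (4 a)] and use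
    that the variance of [q] is at most [4 a^2]. Outside [A] the right-hand
    side is nonnegative, so the rearranged inequality integrates over the
    whole space with nonnegative terms only. *)
Lemma density_le_chi_square (q : Omega -> R) (A : set Omega) (a : R) :
  measurable_fun setT q -> (forall w, 0 <= q w) -> measurable A -> 0 < a ->
  (\int[P]_w (q w)%:E = 1)%E ->
  (\int[P]_w (q w ^+ 2)%:E <= (1 + 4 * a ^+ 2)%:E)%E ->
  (\int[P]_(w in A) (q w)%:E <= P A + (2 * a)%:E)%E.
Proof.
move=> mq q0 mA a0 iq iq2.
have mqA : measurable_fun setT (fun w => q w * \1_A w).
  by apply: measurable_funM => //; exact: measurable_indic.
have mq2 : measurable_fun setT (fun w => q w ^+ 2) by apply: measurable_funX.
have a4 : 0 <= (4 * a)^-1 by rewrite invr_ge0; lra.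
have a2 : 0 <= (2 * a)^-1 by rewrite invr_ge0; lra.
have iA : (\int[P]_(w in A) (q w)%:E = \int[P]_w (q w * \1_A w)%:E)%E.
  rewrite integral_mkcond; apply: eq_integral => w _.
  by rewrite /patch indicE; case: ifP; rewrite ?mulr1 ?mulr0.
have iL : (\int[P]_w (q w * \1_A w + (2 * a)^-1 * q w)%:E =
    \int[P]_(w in A) (q w)%:E + (2 * a)^-1%:E)%E.
  under eq_integral do rewrite EFinD.
  rewrite ge0_integralD//; first last.
  - by apply/measurable_EFinP; exact: measurable_funM.
  - by move=> w _; rewrite lee_fin mulr_ge0.
  - exact/measurable_EFinP.
  - by move=> w _; rewrite lee_fin mulr_ge0.
  rewrite -iA; congr (_ + _)%E.
  under eq_integral do rewrite EFinM.
  rewrite ge0_integralZl_EFin//; last 2 first.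
  - by move=> w _; rewrite lee_fin.
  - exact/measurable_EFinP.
  by rewrite iq mule1.
have iR : (\int[P]_w (\1_A w + ((4 * a)^-1 * q w ^+ 2 + (a + (4 * a)^-1)))%:E <=
    P A + (2 * a + (2 * a)^-1)%:E)%E.
  under eq_integral do rewrite EFinD.
  have mr : measurable_fun setT (fun w => (4 * a)^-1 * q w ^+ 2).
    by apply: measurable_funM.
  rewrite ge0_integralD//; first last.
  - by apply/measurable_EFinP; apply: measurable_funD.
  - move=> w _; rewrite lee_fin addr_ge0// ?mulr_ge0 ?sqr_ge0// addr_ge0//.
    exact: ltW.
  - exact/measurable_EFinP/measurable_indic.
  rewrite integral_indic// setIT leeD2l//.
  under eq_integral do rewrite EFinD.
  rewrite ge0_integralD//; first last.
  - by move=> w _; rewrite lee_fin addr_ge0// ltW.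
  - exact/measurable_EFinP.
  - by move=> w _; rewrite lee_fin mulr_ge0// sqr_ge0.
  have -> : (\int[P]__ (a + (4 * a)^-1)%:E = (a + (4 * a)^-1)%:E)%E.
    rewrite -[RHS]mule1; apply: etrans (integral_cst P measurableT _) _.
    by congr (_ * _)%E; exact: probability_setT.
  under eq_integral do rewrite EFinM.
  rewrite ge0_integralZl_EFin//; last 2 first.
  - by move=> w _; rewrite lee_fin sqr_ge0.
  - exact/measurable_EFinP.
  apply: (@le_trans _ _ ((4 * a)^-1%:E * (1 + 4 * a ^+ 2)%:E + (a + (4 * a)^-1)%:E)%E).
    by rewrite leeD2r// lee_pmul2l// lte_fin invr_gt0; lra.
  rewrite -EFinM -EFinD lee_fin le_eqVlt; apply/orP; left; apply/eqP.
  by field; rewrite gt_eqF.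
have : (\int[P]_w (q w * \1_A w + (2 * a)^-1 * q w)%:E <=
   \int[P]_w (\1_A w + ((4 * a)^-1 * q w ^+ 2 + (a + (4 * a)^-1)))%:E)%E.
  apply: ge0_le_integral => //.
  - by move=> w _; rewrite lee_fin addr_ge0// mulr_ge0.
  - apply/measurable_EFinP; apply: measurable_funD => //.
    exact: measurable_funM.
  - apply/measurable_EFinP; apply: measurable_funD.
      exact: measurable_indic.
    by apply: measurable_funD => //; exact: measurable_funM.
  - move=> w _; rewrite lee_fin -subr_ge0.
    rewrite (_ : _ - _ = (1 - q w) * \1_A w + a + (4 * a)^-1 * (q w - 1) ^+ 2);
      last by field; rewrite gt_eqF.
    have sq : 0 <= (4 * a)^-1 * (q w - 1) ^+ 2 by rewrite mulr_ge0// sqr_ge0.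
    rewrite indicE; case: (w \in A); rewrite ?mulr0 ?mulr1; last by lra.
    (* On A the difference of the two sides is a perfect square. *)
    have : 0 <= (4 * a)^-1 * (q w - 1 - 2 * a) ^+ 2 by rewrite mulr_ge0// sqr_ge0.
    rewrite (_ : _ * (q w - 1 - 2 * a) ^+ 2 =
      1 - q w + a + (4 * a)^-1 * (q w - 1) ^+ 2)//.
    by field; rewrite gt_eqF.
rewrite iL => /le_trans/(_ iR).
by rewrite EFinD addeA leeD2rE.
Qed.

End ChiSquare.

Section ChangeOfMeasure.
Context {R : realType} {p1 p2 p3 : nat}.
Local Notation index := ('I_p1 * 'I_p2 * 'I_p3)%type.
Local Notation tensorM := (g_sigma_algebraType (@cylinders R p1 p2 p3)).
Implicit Types (T : tensor R p1 p2 p3) (x : index).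

Definition entry T x : R := T x.1.1 x.1.2 x.2.

Definition rectangle (B : index -> set R) : set (tensor R p1 p2 p3) :=
  [set Y | forall x, B x (entry Y x)].

Definition rectangles : set (set (tensor R p1 p2 p3)) :=
  [set A | exists B, (forall x, measurable (B x)) /\ A = rectangle B].

Lemma measurable_rectangle (B : index -> set R) : (forall x, measurable (B x)) ->
  measurable (rectangle B : set tensorM).
Proof.
move=> mB.
have -> : rectangle B = \big[setI/setT]_(x : index) [set Y | B x (entry Y x)].
  apply/seteqP; split => Y /=; rewrite -bigcap_seq /=.
    by move=> h x _; exact: h.
  by move=> h x; apply: (h x); rewrite /= mem_index_enum.
apply: bigsetI_measurable => x _; apply: sub_sigma_algebra.
by exists x.1.1, x.1.2, x.2, (B x).
Qed.

Lemma sigma_rectangles : (measurable : set (set tensorM)) `<=` <<s rectangles >>.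
Proof.
apply: smallest_sub; first exact: smallest_sigma_algebra.
move=> _ [a [b [c [B [mB ->]]]]]; apply: sub_sigma_algebra.
exists (fun x => if x == (a, b, c) then B else setT); split.
  by move=> x; case: ifP.
apply/seteqP; split => Y /=.
  by move=> BY x; case: eqP => [->|].
by move=> /(_ (a, b, c)); rewrite /= eqxx.
Qed.

Lemma rectangles_setI_closed : setI_closed rectangles.
Proof.
move=> _ _ [B [mB ->]] [B' [mB' ->]]; exists (fun x => B x `&` B' x); split.
  by move=> x; exact: measurableI.
apply/seteqP; split => Y /=.
  by move=> [h h'] x; split; [exact: h|exact: h'].
by move=> h; split => x; have [] := h x.
Qed.

Context {d : measure_display} {Omega : measurableType d}.
Variables (P : probability Omega R) (Z : 'I_p1 -> 'I_p2 -> 'I_p3 -> {RV P >-> R}).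

Lemma measurable_observation T :
  @measurable_fun _ _ Omega tensorM setT (observation Z T).
Proof.
apply: (@measurability _ _ Omega tensorM setT _ (@cylinders R p1 p2 p3)) => // _ [_ [a [b [c [B [mB ->]]]]] <-].
rewrite setTI.
have mS : measurable_fun setT (fun w => T a b c + Z a b c w) by exact: measurable_funD.
by have := mS measurableT B mB; rewrite setTI.
Qed.

Variable sd : tensor R p1 p2 p3.
Hypotheses (sd_neq0 : forall a b c, sd a b c != 0) (Z_gaussian : gaussian_noise sd Z).
Variables T0 T1 : tensor R p1 p2 p3.

Definition shift x : R := entry T1 x - entry T0 x.
Definition noise x : {RV P >-> R} := Z x.1.1 x.1.2 x.2.

(** The density of the law of the observation of [T1] with respect to that of
    [T0], as a function on the sample space of the noise. *)
Definition likelihood_ratio (w : Omega) : R :=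
  \prod_x tilt (shift x) (entry sd x) (noise x w).

Lemma measurable_likelihood_ratio : measurable_fun setT likelihood_ratio.
Proof.
apply: measurable_prod => x _.
by apply: measurableT_comp; first exact: measurable_tilt.
Qed.

Lemma likelihood_ratio_ge0 w : 0 <= likelihood_ratio w.
Proof. by apply: prodr_ge0 => x _; exact: tilt_ge0. Qed.

Lemma noise_normal x B : measurable B ->
  distribution P (noise x) B = normal_prob 0 (entry sd x) B.
Proof. by move=> mB; exact: (Z_gaussian.2 _ _ _ _ mB). Qed.

Lemma prod_indic_observation (T : tensor R p1 p2 p3) (B : index -> set R) w :
  \prod_x \1_(B x) (entry T x + noise x w) =
  \1_(observation Z T @^-1` rectangle B) w :> R.
Proof.
rewrite [RHS]indicE; case: (boolP (w \in _)); rewrite ?inE ?notin_setE /= => h.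
  by rewrite big1// => x _; rewrite indicE mem_set//; exact: h.
have /existsNP[x nB] := h.
rewrite (bigD1 x)//= indicE memNset ?mul0r//.
Qed.

(** By independence both sides split into one factor per entry, and each
    factor is a one-dimensional change of mean. *)
Lemma likelihood_ratio_rectangle (B : index -> set R) :
  (forall x, measurable (B x)) ->
  (\int[P]_(w in observation Z T0 @^-1` rectangle B) (likelihood_ratio w)%:E =
   P (observation Z T1 @^-1` rectangle B))%E.
Proof.
move=> mB.
have mob T : measurable (observation Z T @^-1` rectangle B).
  by have := measurable_observation T measurableT (measurable_rectangle mB);
    rewrite setTI.
have mD c : measurable_fun setT (fun x : R => c + x) by exact: measurable_funD.
have m1 x c : measurable_fun setT (fun z : R => \1_(B x) (c + z) : R).
  by apply: (measurableT_comp (f := \1_(B x) : R -> R)) => //; exact: measurable_indic.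
have mS x : measurable ((fun w => entry T1 x + noise x w) @^-1` B x).
  by rewrite -[X in measurable X]setTI; apply: (measurableT_comp (mD (entry T1 x))) => //.
pose e x := fine (P [set w | B x (entry T1 x + noise x w)]).
transitivity (\int[P]_w (\prod_x (tilt (shift x) (entry sd x) (noise x w) *
    \1_(B x) (entry T0 x + noise x w)))%:E)%E.
  rewrite integral_mkcond; apply: eq_integral => w _.
  rewrite big_split/= prod_indic_observation /patch indicE.
  by case: ifP; rewrite ?mulr1 ?mulr0.
transitivity ((\prod_x e x)%:E)%E.
  apply: (expectation_prod Z_gaussian.1 (g := fun x z =>
    tilt (shift x) (entry sd x) z * \1_(B x) (entry T0 x + z))) => [x|x z|x].
  - by apply: measurable_funM => //; exact: measurable_tilt.
  - by rewrite mulr_ge0// tilt_ge0.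
  - rewrite (expectation_tilt_indic (sd_neq0 _ _ _) (@noise_normal x))//.
    rewrite /e fineK; last by apply: fin_num_measure; exact: mS.
    by rewrite /shift addrC subrK.
symmetry; transitivity (\int[P]_w (\1_(observation Z T1 @^-1` rectangle B) w)%:E)%E.
  by rewrite integral_indic// setIT.
transitivity (\int[P]_w (\prod_x \1_(B x) (entry T1 x + noise x w))%:E)%E.
  by apply: eq_integral => w _; rewrite prod_indic_observation.
apply: (expectation_prod Z_gaussian.1 (g := fun x z => \1_(B x) (entry T1 x + z))) => // x.
rewrite /e fineK; last by apply: fin_num_measure; exact: mS.
transitivity (\int[P]_w (\1_((fun w => entry T1 x + noise x w) @^-1` B x) w)%:E)%E.
  by [].
by rewrite integral_indic// setIT.
Qed.

(** Both sides are measures in [F], and the rectangles form a generating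
    family stable under intersection. *)
Lemma likelihood_ratioP (F : set (tensor R p1 p2 p3)) : measurable (F : set tensorM) ->
  (\int[P]_(w in observation Z T0 @^-1` F) (likelihood_ratio w)%:E =
   P (observation Z T1 @^-1` F))%E.
Proof.
move=> mF.
pose obs T : Omega -> tensorM := observation Z T.
pose q := density_measure P measurable_likelihood_ratio likelihood_ratio_ge0.
have rP := likelihood_ratio_rectangle.
have RT : setT = rectangle (fun=> setT) by apply/seteqP; split.
pose m0 : {measure set tensorM -> \bar R} := pushforward q (obs T0).
pose m1 : {measure set tensorM -> \bar R} := pushforward P (obs T1).
have mo := measurable_observation.
suff : m0 (mo T0) F = m1 (mo T1) F by [].
apply: (@g_sigma_algebra_measure_unique _ _ tensorM rectangles _ (fun=> setT)
  _ _ (m0 (mo T0)) (m1 (mo T1))) => //.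
- by move=> _ [B [mB ->]]; exact: measurable_rectangle.
- by move=> _; exists (fun=> setT).
- by rewrite bigcup_const.
- exact: rectangles_setI_closed.
- by move=> _ [B [mB ->]]; exact: rP.
- move=> _; rewrite RT [X in (X < _)%E](rP (fun=> setT))//.
  have := measurable_observation T1 measurableT measurableT.
  by rewrite setTI -RT => mT; rewrite ltey_eq fin_num_measure.
- exact: sigma_rectangles.
Qed.

Lemma likelihood_ratio_sqr :
  (\int[P]_w (likelihood_ratio w ^+ 2)%:E =
   (expR (\sum_x shift x ^+ 2 / entry sd x ^+ 2))%:E)%E.
Proof.
under eq_integral do rewrite /likelihood_ratio -prodrXl.
rewrite expR_sum.
apply: (expectation_prod Z_gaussian.1 (g := fun x z => tilt (shift x) (entry sd x) z ^+ 2)) => [x|x z|x].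
- by apply: measurable_funX; exact: measurable_tilt.
- exact: sqr_ge0.
- exact: (expectation_tilt_sqr (sd_neq0 _ _ _) (@noise_normal x)).
Qed.

End ChangeOfMeasure.

Section TwoPoint.
Context {R : realType} {p1 p2 p3 : nat}.
Local Notation tensorM := (g_sigma_algebraType (@cylinders R p1 p2 p3)).
Context {d : measure_display} {Omega : measurableType d}.
Variables (P : probability Omega R) (Z : 'I_p1 -> 'I_p2 -> 'I_p3 -> {RV P >-> R}).

Lemma measurable_covers (ci : tensor R p1 p2 p3 -> R * R) (t : R) :
  measurable_interval ci ->
  measurable ([set Y | (ci Y).1 <= t <= (ci Y).2] : set tensorM).
Proof.
move=> mci.
have m1 := measurableT_comp measurable_fst mci.
have m2 := measurableT_comp measurable_snd mci.
have := measurableI _ _ (m1 measurableT _ (measurable_itv `]-oo, t]))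
  (m2 measurableT _ (measurable_itv `[t, +oo[)).
rewrite !setTI; congr measurable; apply/seteqP; split => Y /=.
  by rewrite !in_itv/= andbT => -[-> ->].
by rewrite !in_itv/= andbT => /andP[].
Qed.

Lemma measurable_ci_length (ci : tensor R p1 p2 p3 -> R * R) :
  measurable_interval ci -> @measurable_fun _ _ tensorM R setT (fun Y => ci_length (ci Y)).
Proof.
move=> mci; apply: (measurableT_comp (f := @Num.norm R R)) => //.
apply: measurable_funB.
- exact: measurableT_comp measurable_snd mci.
- exact: measurableT_comp measurable_fst mci.
Qed.

Variable sd : tensor R p1 p2 p3.
Hypotheses (sd_neq0 : forall a b c, sd a b c != 0) (Z_gaussian : gaussian_noise sd Z).

(** Under [T0] the interval covers the entry of [T0] with probability at least
    [1 - alpha], and that of [T1] with probability at least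
    [1 - alpha - 2 * a] by the change of measure; where it covers both, it is
    at least as long as their distance. *)
Lemma two_point_length (T0 T1 : tensor R p1 p2 p3) (ci : tensor R p1 p2 p3 -> R * R)
    (alpha a : R) i j k :
  0 < a -> measurable_interval ci ->
  ((1 - alpha)%:E <= coverage Z ci i j k T0)%E ->
  ((1 - alpha)%:E <= coverage Z ci i j k T1)%E ->
  expR (\sum_x shift T0 T1 x ^+ 2 / entry sd x ^+ 2) <= 1 + 4 * a ^+ 2 ->
  (((1 - 2 * alpha - 2 * a) * `|T1 i j k - T0 i j k|)%:E <= expected_length Z ci T0)%E.
Proof.
move=> a0 mci cov0 cov1 chi.
pose F t : set tensorM := [set Y | (ci Y).1 <= t <= (ci Y).2].
have mF t : measurable (F t) by exact: measurable_covers.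
have mo T A : measurable (A : set tensorM) -> measurable (observation Z T @^-1` A).
  by move=> mA; have := measurable_observation Z T measurableT mA; rewrite setTI.
set A0 := observation Z T0 @^-1` F (T0 i j k).
set A1 := observation Z T0 @^-1` F (T1 i j k).
have mA0 : measurable A0 by exact: mo.
have mA1 : measurable A1 by exact: mo.
have PA1 : ((1 - alpha - 2 * a)%:E <= P A1)%E.
  have /= := density_le_chi_square (P := P) (measurable_likelihood_ratio Z sd T0 T1)
    (likelihood_ratio_ge0 Z sd T0 T1) mA1 a0.
  rewrite (likelihood_ratio_sqr sd_neq0 Z_gaussian) lee_fin chi.
  have -> : (\int[P]_w (likelihood_ratio Z sd T0 T1 w)%:E = 1)%E.
    have := likelihood_ratioP sd_neq0 Z_gaussian T0 T1 (@measurableT _ tensorM).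
    by rewrite !preimage_setT probability_setT.
  rewrite (likelihood_ratioP sd_neq0 Z_gaussian T0 T1 (mF _)) => /(_ erefl isT) H.
  move: (le_trans cov1 H).
  rewrite -(fineK (fin_num_measure P A1 mA1)) -EFinD !lee_fin; lra.
have PA0 : ((1 - alpha)%:E <= P A0)%E by [].
have mA : measurable (A0 `&` A1) by exact: measurableI.
have PA : ((1 - 2 * alpha - 2 * a)%:E <= P (A0 `&` A1))%E.
  have PU : (P A0 + P A1 = P (A0 `|` A1) + P (A0 `&` A1))%E.
    by rewrite measureUfinr ?subeK// ?fin_num_measure// ltey_eq fin_num_measure.
  have PU1 : (P (A0 `|` A1) <= 1)%E by apply: probability_le1; exact: measurableU.
  have : ((1 - alpha)%:E + (1 - alpha - 2 * a)%:E <= 1 + P (A0 `&` A1))%E.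
    by rewrite (le_trans (leeD PA0 PA1))// PU leeD2r.
  have Pf : (P (A0 `&` A1) \is a fin_num) by apply: fin_num_measure.
  by rewrite -(fineK Pf) -!EFinD !lee_fin; lra.
set D := `|_ - _|.
rewrite /expected_length unlock.
have mL : measurable_fun setT (fun w => ci_length (ci (observation Z T0 w))).
  exact: (measurableT_comp (measurable_ci_length mci) (measurable_observation Z T0)).
apply: (@le_trans _ _ (\int[P]_w (D * \1_(A0 `&` A1) w)%:E)%E).
  under eq_integral do rewrite EFinM.
  rewrite ge0_integralZl_EFin ?normr_ge0//; last exact/measurable_EFinP/measurable_indic.
  by rewrite integral_indic// setIT mulrC EFinM lee_wpmul2l// lee_fin normr_ge0.
apply: ge0_le_integral => //.
- by move=> w _; rewrite lee_fin mulr_ge0// normr_ge0.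
- by apply/measurable_EFinP; apply: measurable_funM => //; exact: measurable_indic.
- exact/measurable_EFinP.
move=> w _; rewrite lee_fin indicE; case: (boolP (w \in _)); last by rewrite mulr0 normr_ge0.
rewrite inE mulr1 => -[/andP[l0 u0] /andP[l1 u1]].
rewrite /D /ci_length; set l := (ci _).1 in l0 l1 *; set u := (ci _).2 in u0 u1 *.
have lu : l <= u by exact: le_trans l0 u0.
by rewrite [leRHS]ger0_norm ?subr_ge0// ler_norml; apply/andP; split; lra.
Qed.

Lemma minimax_two_point (Th : set (tensor R p1 p2 p3)) (T0 T1 : tensor R p1 p2 p3)
    (alpha a L : R) i j k :
  Th T0 -> Th T1 -> 0 < a ->
  expR (\sum_x shift T0 T1 x ^+ 2 / entry sd x ^+ 2) <= 1 + 4 * a ^+ 2 ->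
  L <= (1 - 2 * alpha - 2 * a) * `|T1 i j k - T0 i j k| ->
  (L%:E <= minimax_length Z Th alpha i j k)%E.
Proof.
move=> Th0 Th1 a0 chi LD; apply: le_ereal_inf_tmp => _ [ci [mci cov] <-].
apply: ereal_sup_ge; exists (expected_length Z ci T0); first by exists T0.
have covT T : Th T -> ((1 - alpha)%:E <= coverage Z ci i j k T)%E.
  by move=> ThT; apply: (le_trans cov); apply: ereal_inf_lbound; exists T.
apply: le_trans (two_point_length a0 mci (covT _ Th0) (covT _ Th1) chi).
by rewrite lee_fin.
Qed.

End TwoPoint.

(** * Orthonormal frames with small rows *)

Section Frames.
Context {R : realType}.

Lemma card_residue_class (p r : nat) (a : 'I_r) :
  (p %/ r <= #|[set m : 'I_p | m %% r == a :> nat]%SET|)%N.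
Proof.
have r0 : (0 < r)%N by apply: leq_ltn_trans (ltn_ord a).
have lt_p (s : 'I_(p %/ r)) : (s * r + a < p)%N.
  have := ltn_ord s; have := ltn_ord a; have := leq_trunc_div p r; nia.
pose f s := Ordinal (lt_p s).
have f_inj : injective f.
  move=> s t /(congr1 val) /= /eqP; rewrite eqn_add2r eqn_pmul2r//.
  by move=> /eqP /val_inj.
rewrite -[X in (X <= _)%N]card_ord -(card_imset _ f_inj).
apply/subset_leq_card/fintype.subsetP => _ /imsetP[s _ ->].
by rewrite finset.inE /= modnMDl modn_small.
Qed.

(** The column [a] is the normalised indicator of the indices congruent to [a]
    modulo [r] and different from [i]. Row [m] has a single nonzero entry, and
    a residue class keeps at least [p %/ r - 1 >= p / (4 r)] indices. *)
Lemma zero_row_frame (p r : nat) (i : 'I_p) : (0 < r)%N -> (2 * r <= p)%N ->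
  exists G : 'M[R]_(p, r), [/\ G^T *m G = 1%:M, forall a, G i a = 0
    & forall m, \sum_a G m a ^+ 2 <= 4 * (r%:R / p%:R)].
Proof.
move=> r0 rp.
pose S (a : 'I_r) : {set 'I_p} := [set m : 'I_p | (m %% r == a)%N & m != i]%SET.
have cardS a : (p <= 4 * r * #|S a|)%N.
  have := card_residue_class p a.
  rewrite (cardsD1 i) => le1.
  have -> : S a = ([set m : 'I_p | (m %% r)%N == a :> nat] :\ i)%SET.
    by apply/setP => m; rewrite !finset.inE andbC.
  move: le1; set n := #|(_ :\ i)%SET| => le1.
  have le2 : (p %/ r <= n.+1)%N by apply: leq_trans le1 _; case: (_ \in _).
  have := divn_eq p r; have := ltn_pmod p r0.
  have : (2 <= p %/ r)%N by rewrite leq_divRL.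
  nia.
have p0 : (0 < p)%N by apply: leq_ltn_trans (ltn_ord i).
have S0 a : 0 < #|S a|%:R :> R.
  by rewrite ltr0n; have := cardS a; case: #|S a| => //; rewrite muln0; lia.
exists (\matrix_(m, a) (if m \in S a then (Num.sqrt #|S a|%:R)^-1 else 0)); split.
- apply/matrixP => a b; rewrite !mxE.
  have [<-|ab] := eqVneq a b; last first.
    rewrite big1// => m _; rewrite !mxE !finset.inE.
    have [ma|] := eqVneq (m %% r)%N (val a); last by rewrite mul0r.
    have [mb|] := eqVneq (m %% r)%N (val b); last by rewrite mulr0.
    by case/eqP: ab; apply: val_inj; rewrite -ma -mb.
  under eq_bigr do rewrite !mxE.
  rewrite (bigID (mem (S a)))/= [X in _ + X]big1 ?addr0; last first.
    by move=> m /negbTE ->; rewrite mul0r.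
  under eq_bigr => m mS do rewrite mS -expr2 exprVn sqr_sqrtr ?ler0n//.
  by rewrite sumr_const -[_ *+ _]mulr_natr mulVf// gt_eqF.
- by move=> a; rewrite mxE finset.inE eqxx andbF.
- move=> m; have mr : (m %% r < r)%N by rewrite ltn_mod.
  rewrite (bigD1 (Ordinal mr))//= big1 ?addr0; last first.
    move=> a am; rewrite mxE finset.inE.
    have [ma|] := eqVneq (m %% r)%N (val a); last by rewrite expr0n.
    by case/eqP: am; apply: val_inj; rewrite -ma.
  rewrite mxE; case: ifP => _; last first.
    by rewrite expr0n/= mulr_ge0// divr_ge0.
  rewrite exprVn sqr_sqrtr ?ler0n//.
  rewrite mulrA ler_pdivlMr ?ltr0n// mulrC ler_pdivrMr//.
  by rewrite -natrM -natrM ler_nat.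
Qed.

Lemma sum_sqr_rv n (v : 'rV[R]_n) : \sum_a v 0 a ^+ 2 = (v *m v^T) 0 0.
Proof. by rewrite mxE; apply: eq_bigr => a _; rewrite !mxE expr2. Qed.

Lemma sum_sqr_cv n (v : 'cV[R]_n) : \sum_a v a 0 ^+ 2 = (v^T *m v) 0 0.
Proof. by rewrite mxE; apply: eq_bigr => a _; rewrite !mxE expr2. Qed.

(** The unit vector [G y^T] of the frame is turned, by the angle of sine [s],
    towards the coordinate vector [e_i], which is orthogonal to the frame since
    row [i] of [G] vanishes. The rows other than [i] only lose length in the
    direction [y], and row [i] becomes [s *: y]. *)
Lemma rotate_frame (p r : nat) (G : 'M[R]_(p, r)) (i : 'I_p) (y : 'rV[R]_r) (s B : R) :
  G^T *m G = 1%:M -> (forall a, G i a = 0) -> (forall m, \sum_a G m a ^+ 2 <= B) ->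
  \sum_a y 0 a ^+ 2 = 1 -> 0 <= s <= 1 -> s ^+ 2 <= B ->
  exists g : 'cV[R]_p, [/\ (G + g *m y)^T *m (G + g *m y) = 1%:M,
    forall m, \sum_a (G + g *m y) m a ^+ 2 <= B,
    \sum_m g m 0 ^+ 2 <= 2 * s ^+ 2 & g i 0 = s].
Proof.
move=> GG Gi GB y1 /andP[s0 s1] sB.
(* The cosine of the angle; [g] below is the displacement of [f]. *)
pose c := Num.sqrt (1 - s ^+ 2).
have s21 : s ^+ 2 <= 1 by rewrite expr_le1.
have c2 : c ^+ 2 = 1 - s ^+ 2 by rewrite sqr_sqrtr// subr_ge0.
have c0 : 0 <= c by exact: sqrtr_ge0.
have c1 : 1 - c <= s ^+ 2 by nra.
have [f fE] : exists f : 'cV[R]_p, f = G *m y^T by eexists.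
have [g gE] : exists g : 'cV[R]_p, g = (c - 1) *: f + s *: delta_mx i 0 by eexists.
have yy : y *m y^T = 1%:M.
  by apply/matrixP => a b; rewrite !ord1 -sum_sqr_rv y1 mxE eqxx.
have Ge : G^T *m delta_mx i 0 = 0 :> 'cV_r.
  apply/matrixP => a b; rewrite ord1 mxE (bigD1 i)//= big1 ?addr0.
    by rewrite !mxE Gi mul0r.
  by move=> m /negbTE mi; rewrite !mxE mi mulr0.
have ee : (delta_mx i 0 : 'cV[R]_p)^T *m (delta_mx i 0 : 'cV_p) = 1%:M.
  rewrite trmx_delta mul_delta_mx; apply/matrixP => a b.
  by rewrite !ord1 !mxE !eqxx.
have Gg : G^T *m g = (c - 1) *: y^T.
  by rewrite gE mulmxDr -!scalemxAr Ge scaler0 addr0 fE mulmxA GG mul1mx.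
have fT : f^T = y *m G^T by rewrite fE trmx_mul trmxK.
have ff : f^T *m f = 1%:M by rewrite fT fE mulmxA -(mulmxA y) GG mulmx1.
have fe : f^T *m delta_mx i 0 = 0 :> ('M[R]_1) by rewrite fT -mulmxA Ge mulmx0.
have ef : (delta_mx i 0)^T *m f = 0 :> ('M[R]_1).
  by rewrite -[LHS]trmxK trmx_mul trmxK fe trmx0.
have gg : g^T *m g = (2 * (1 - c))%:M.
  have -> : g^T = (c - 1) *: f^T + s *: (delta_mx i 0)^T.
    by rewrite gE; apply/matrixP => a b; rewrite !mxE.
  rewrite gE mulmxDl !mulmxDr -!scalemxAl -!scalemxAr ff fe ef ee.
  rewrite !scaler0 addr0 add0r !scalerA !scalemx1 -raddfD/=; congr (_%:M).
  by rewrite -[s * s]expr2; move: c2; rewrite expr2; nra.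
have fi : f i 0 = 0 by rewrite fE mxE big1// => a _; rewrite Gi mul0r.
have gi : g i 0 = s by rewrite gE !mxE fi mulr0 add0r !eqxx mulr1.
have gm m : m != i -> g m 0 = (c - 1) * f m 0.
  by move=> /negbTE mi; rewrite gE !mxE mi mulr0 addr0.
exists g; split.
- have -> : (G + g *m y)^T = G^T + y^T *m g^T.
    by rewrite -trmx_mul; apply/matrixP => a b; rewrite !mxE.
  rewrite mulmxDl !mulmxDr GG.
  have -> : G^T *m (g *m y) = (c - 1) *: (y^T *m y) by rewrite mulmxA Gg -scalemxAl.
  have -> : y^T *m g^T *m G = (c - 1) *: (y^T *m y).
    rewrite -mulmxA -[g^T *m G]trmxK trmx_mul trmxK Gg linearZ/= trmxK.
    by rewrite -scalemxAr.
  have -> : y^T *m g^T *m (g *m y) = (2 * (1 - c)) *: (y^T *m y).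
    by rewrite -mulmxA (mulmxA g^T) gg mul_scalar_mx -scalemxAr.
  rewrite -addrA -!scalerDl (_ : c - 1 + (c - 1 + 2 * (1 - c)) = 0).
    by rewrite scale0r addr0.
  by ring.
- move=> m.
  have ex : \sum_a (G + g *m y) m a ^+ 2 =
      \sum_a G m a ^+ 2 + 2 * g m 0 * f m 0 + g m 0 ^+ 2.
    have -> : g m 0 ^+ 2 = \sum_a g m 0 ^+ 2 * y 0 a ^+ 2.
      by rewrite -mulr_sumr y1 mulr1.
    rewrite fE [(G *m y^T) m 0]mxE mulr_sumr -!big_split/=.
    by apply: eq_bigr => a _; rewrite !mxE big_ord1; ring.
  rewrite ex; have [->|mi] := eqVneq m i.
    by rewrite fi gi mulr0 addr0 big1 ?add0r// => a _; rewrite Gi expr0n.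
  apply: le_trans (GB m); rewrite gm// -addrA gerDl.
  have -> : 2 * ((c - 1) * f m 0) * f m 0 + ((c - 1) * f m 0) ^+ 2 =
    (c ^+ 2 - 1) * f m 0 ^+ 2 by ring.
  by rewrite mulr_le0_ge0 ?sqr_ge0// c2; have := sqr_ge0 s; lra.
- by rewrite sum_sqr_cv gg mxE eqxx mulr1n; lra.
- exact: gi.
Qed.

Lemma sum_sqr_rank1 p n (g : 'cV[R]_p) (w : 'rV[R]_n) :
  \sum_m \sum_l (g *m w) m l ^+ 2 = (\sum_m g m 0 ^+ 2) * (\sum_l w 0 l ^+ 2).
Proof.
rewrite mulr_suml; apply: eq_bigr => m _; rewrite mulr_sumr.
by apply: eq_bigr => l _; rewrite mxE big_ord1 exprMn.
Qed.

End Frames.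

(** * Perturbing the left factor of a decomposition *)

Section MatrixPerturbation.
Context {R : realType}.

Lemma enorm_row m n (M : 'M[R]_(m, n)) l : enorm (row l M) = Num.sqrt (\sum_a M l a ^+ 2).
Proof. by congr Num.sqrt; apply: eq_bigr => a _; rewrite mxE. Qed.

(** With [v] the row [l] of [V], a rotation of sine [s] in the direction [y]
    changes the matrix by about [s] times the row [y diag(L) V^T], placed in
    row [i]. For [y = (v / L) / |v / L|] this row is [v V^T / |v / L|], whose
    entry [l] is [|v|^2 / |v / L|] and whose norm is [|v| / |v / L|]. The sine
    is scaled so that the total change is at most [tau], and the lower bound on
    the [|L 0 a|] makes it at most [tau / (2 * lam)]. *)
Lemma perturb_left_factor (p r n : nat) (i : 'I_p) (l : 'I_n) (L : 'rV[R]_r)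
    (V : 'M[R]_(n, r)) (lam tau : R) :
  (0 < r)%N -> (2 * r <= p)%N -> V^T *m V = 1%:M -> 0 < lam ->
  (forall a, lam <= `|L 0 a|) -> 0 <= tau -> tau <= lam ->
  tau ^+ 2 / lam ^+ 2 <= 4 * (r%:R / p%:R) ->
  exists G0 G1 : 'M[R]_(p, r),
    [/\ G0^T *m G0 = 1%:M, G1^T *m G1 = 1%:M,
        forall m, \sum_a G0 m a ^+ 2 <= 4 * (r%:R / p%:R)
      & forall m, \sum_a G1 m a ^+ 2 <= 4 * (r%:R / p%:R)] /\
    [/\ \sum_m \sum_k ((G1 - G0) *m diag_mx L *m V^T) m k ^+ 2 <= tau ^+ 2
      & tau / 2 * enorm (row l V) <= ((G1 - G0) *m diag_mx L *m V^T) i l].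
Proof.
move=> r0 rp VV lam0 lamL tau0 taul taub.
have [G [GG Gi GB]] := @zero_row_frame R _ _ i r0 rp.
pose N := \sum_a V l a ^+ 2; pose W := \sum_a (V l a / L 0 a) ^+ 2.
have N0 : 0 <= N by apply: sumr_ge0 => a _; exact: sqr_ge0.
have [NE|Nn0] := eqVneq N 0.
  exists G, G; split => //; rewrite subrr !mul0mx mxE enorm_row -/N NE sqrtr0 mulr0.
  split => //; rewrite big1 ?sqr_ge0// => m _.
  by rewrite big1// => k _; rewrite mxE expr0n.
have Npos : 0 < N by rewrite lt_def Nn0.
have L0 a : L 0 a != 0 by rewrite -normr_gt0 (lt_le_trans lam0).
have lamL2 a : lam ^+ 2 <= L 0 a ^+ 2.
  by rewrite -[leRHS]real_normK ?num_real// lerXn2r ?nnegrE// ltW.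
have WN : lam ^+ 2 * W <= N.
  rewrite /W mulr_sumr; apply: ler_sum => a _.
  rewrite expr_div_n mulrA ler_pdivrMr ?exprn_even_gt0//= mulrC.
  by rewrite ler_wpM2l ?sqr_ge0.
have Wpos : 0 < W.
  rewrite lt_def sumr_ge0 ?andbT => [|a _]; last exact: sqr_ge0.
  apply: contra_neq Nn0; move/eqP; rewrite psumr_eq0 => [/allP h|a _]; last exact: sqr_ge0.
  rewrite /N big1// => a _; apply/eqP; have := h a (mem_index_enum a).
  by rewrite /= !sqrf_eq0 mulf_eq0 invr_eq0 (negbTE (L0 a)) orbF.
pose w := Num.sqrt W; pose v := Num.sqrt N.
have w0 : 0 < w by rewrite sqrtr_gt0.
have v0 : 0 < v by rewrite sqrtr_gt0.
have w2 : w ^+ 2 = W by rewrite sqr_sqrtr// ltW.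
have v2 : v ^+ 2 = N by rewrite sqr_sqrtr// ltW.
pose y := \row_a (V l a / L 0 a / w).
pose s := tau / 2 * (w / v).
have y1 : \sum_a y 0 a ^+ 2 = 1.
  under eq_bigr do rewrite mxE expr_div_n.
  by rewrite -mulr_suml -/W w2 divff// gt_eqF.
have s0 : 0 <= s by rewrite mulr_ge0 ?divr_ge0// ltW.
have s2 : s ^+ 2 <= tau ^+ 2 / lam ^+ 2 / 4.
  have WN' : W / N <= (lam ^+ 2)^-1.
    by rewrite ler_pdivrMr// mulrC ler_pdivlMr ?exprn_gt0// mulrC.
  rewrite /s exprMn !expr_div_n w2 v2.
  rewrite (_ : tau ^+ 2 / lam ^+ 2 / 4 = tau ^+ 2 / 2 ^+ 2 * (lam ^+ 2)^-1).
    by rewrite ler_wpM2l// divr_ge0 ?sqr_ge0.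
  by rewrite mulrAC; congr (_ / _ / _); ring.
have t2 : 0 <= tau ^+ 2 / lam ^+ 2 by rewrite divr_ge0 ?sqr_ge0.
have t21 : tau ^+ 2 / lam ^+ 2 <= 1.
  by rewrite ler_pdivrMr ?exprn_gt0// mul1r lerXn2r ?nnegrE// ltW.
have s1 : 0 <= s <= 1.
  by rewrite s0 -(expr_le1 (n := 2))//; lra.
have sB : s ^+ 2 <= 4 * (r%:R / p%:R) by lra.
have [g [G1G1 G1B g2 gi]] := rotate_frame GG Gi GB y1 s1 sB.
exists G, (G + g *m y); split => //.
rewrite [_ - G]addrC addKr -!mulmxA.
set z := y *m _.
have yL a : (y *m diag_mx L) 0 a = V l a / w.
  by rewrite mul_mx_diag !mxE mulrAC mulfVK ?L0// mulrAC divfK.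
have zz : \sum_k z 0 k ^+ 2 = N / W.
  rewrite sum_sqr_rv /z mulmxA trmx_mul trmxK -mulmxA (mulmxA V^T) VV mul1mx.
  rewrite -sum_sqr_rv; under eq_bigr do rewrite yL expr_div_n.
  by rewrite -mulr_suml w2.
have zl : z 0 l = N / w.
  rewrite /z mulmxA mxE mulr_suml; apply: eq_bigr => a _.
  by rewrite yL mxE expr2 mulrAC.
split.
  rewrite sum_sqr_rank1 zz.
  have : (\sum_m g m 0 ^+ 2) * (N / W) <= 2 * s ^+ 2 * (N / W).
    by rewrite ler_wpM2r// divr_ge0// ltW.
  rewrite /s exprMn !expr_div_n w2 v2.
  have -> : 2 * (tau ^+ 2 / 2 ^+ 2 * (W / N)) * (N / W) = tau ^+ 2 / 2.
    by field; rewrite !gt_eqF.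
  by move/le_trans; apply; have := sqr_ge0 tau; lra.
rewrite mxE big_ord1 gi zl enorm_row -/N -/v /s.
rewrite le_eqVlt; apply/orP; left; apply/eqP.
by rewrite -v2; field; rewrite !gt_eqF.
Qed.

(** The singular values of [A] are positive, so [Q] has full row rank and [U]
    spans the same space as [U1]; [O] is the change of basis. It diagonalises
    [A *m A^T] with the squares of [L] as eigenvalues, which makes every
    [|L 0 a|] a singular value of [A]. The absolute values leave the sign of
    [L] free, so that it can be the single entry of a core of rank one. *)
Lemma align_svd (p r n m : nat) (U1 U : 'M[R]_(p, r)) (Q : 'M[R]_(r, n))
    (A : 'M[R]_(r, m)) (L : 'rV[R]_r) (V : 'M[R]_(n, r)) (lam : R) :
  U1^T *m U1 = 1%:M -> U^T *m U = 1%:M -> V^T *m V = 1%:M ->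
  U1 *m Q = U *m diag_mx L *m V^T -> Q *m Q^T = A *m A^T ->
  0 < lam -> (forall s, singular_values A s -> lam <= s) ->
  exists O : 'M[R]_r, [/\ O *m O^T = 1%:M, Q = O *m diag_mx L *m V^T
    & forall a, lam <= `|L 0 a|].
Proof.
move=> U1U1 UU VV UQ QQ lam0 sv.
pose D := diag_mx L *m diag_mx L.
have DE : (diag_mx L *m V^T) *m (diag_mx L *m V^T)^T = D.
  by rewrite trmx_mul trmxK mulmxA -(mulmxA _ V^T) VV mulmx1 tr_diag_mx.
pose O := U1^T *m U.
have QE : Q = O *m (diag_mx L *m V^T).
  by rewrite -[LHS]mul1mx -U1U1 -mulmxA UQ /O !mulmxA.
have QQE : Q *m Q^T = O *m D *m O^T.
  by rewrite QE -DE; set W := diag_mx L *m V^T; rewrite trmx_mul !mulmxA.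
have AU : A *m A^T \in unitmx.
  apply/negP => /negP nu.
  have : lam <= 0; last by rewrite leNgt lam0.
  apply: sv; split => //; rewrite expr0n/=.
  by rewrite /eigenvalue /eigenspace raddf0 subr0 kermx_eq0 row_free_unit.
have U1E : U1 = U *m O^T.
  have : U1 *m (A *m A^T) = U *m (D *m O^T).
    have UQ' : U1 *m Q = U *m (diag_mx L *m V^T) by rewrite UQ mulmxA.
    rewrite -QQ mulmxA UQ' [in Q^T]QE -DE; set W := diag_mx L *m V^T.
    by rewrite trmx_mul !mulmxA.
  move=> /(congr1 (fun M => M *m invmx (A *m A^T))); rewrite mulmxK// => E.
  have : U *m (U^T *m U1) = U1.
    by rewrite E -!mulmxA (mulmxA U^T) UU mul1mx.
  by rewrite /O trmx_mul trmxK.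
have OO : O *m O^T = 1%:M by rewrite {1}/O -mulmxA -U1E U1U1.
clearbody O; exists O; split => //; first by rewrite QE mulmxA.
move=> a; apply: sv; split => //.
rewrite real_normK ?num_real//.
apply/eigenvalueP; exists (row a O^T).
  rewrite -QQ QQE -row_mul !mulmxA (mulmx1C OO) mul1mx.
  rewrite -mulmxA row_mul row_diag_mx -scalemxAl -rowE.
  by rewrite row_mul row_diag_mx -scalemxAl -rowE scalerA expr2.
apply/eqP => /(congr1 (fun v => v *m O)); rewrite mul0mx -row_mul (mulmx1C OO).
move/rowP/(_ a); rewrite !mxE eqxx => /eqP; rewrite oner_eq0.
by [].
Qed.

End MatrixPerturbation.

(** * Perturbing one mode of a tensor *)

Section TensorPerturbation.
Context {R : realType}.

Definition tucker {p1 p2 p3 r1 r2 r3} (S : tensor R r1 r2 r3) (U1 : 'M[R]_(p1, r1))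
    (U2 : 'M[R]_(p2, r2)) (U3 : 'M[R]_(p3, r3)) : tensor R p1 p2 p3 :=
  mode_prod3 (mode_prod2 (mode_prod1 S U1) U2) U3.

Definition rot {p1 p2 p3} (T : tensor R p1 p2 p3) : tensor R p2 p3 p1 :=
  fun j k i => T i j k.

Lemma tuckerE p1 p2 p3 r1 r2 r3 (S : tensor R r1 r2 r3) (U1 : 'M[R]_(p1, r1))
    (U2 : 'M[R]_(p2, r2)) (U3 : 'M[R]_(p3, r3)) i j k :
  tucker S U1 U2 U3 i j k =
  \sum_a \sum_b \sum_c S a b c * U1 i a * U2 j b * U3 k c.
Proof.
rewrite /tucker /mode_prod3.
under eq_bigr do rewrite /mode_prod2 mulr_suml.
rewrite exchange_big [RHS]exchange_big; apply: eq_bigr => b _ /=.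
rewrite [RHS]exchange_big; apply: eq_bigr => c _ /=.
by rewrite /mode_prod1 !mulr_suml.
Qed.

Lemma rot_tucker p1 p2 p3 r1 r2 r3 (S : tensor R r1 r2 r3) (U1 : 'M[R]_(p1, r1))
    (U2 : 'M[R]_(p2, r2)) (U3 : 'M[R]_(p3, r3)) :
  rot (tucker S U1 U2 U3) = tucker (rot S) U2 U3 U1.
Proof.
apply/funext => j; apply/funext => k; apply/funext => i.
rewrite /rot !tuckerE exchange_big; apply: eq_bigr => b _ /=.
rewrite exchange_big; apply: eq_bigr => c _; apply: eq_bigr => a _ /=.
by rewrite -!mulrA; congr (_ * _); ring.
Qed.

Lemma sum_mxvec_index m n (F : 'I_(m * n) -> R) :
  \sum_l F l = \sum_j \sum_k F (mxvec_index j k).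
Proof.
rewrite (reindex _ (curry_mxvec_bij m n)) pair_bigA /=.
by apply: eq_bigr => -[].
Qed.

Lemma matricization1E p1 p2 p3 (T : tensor R p1 p2 p3) i j k :
  matricization1 T i (mxvec_index j k) = T i j k.
Proof.
have -> : matricization1 T i (mxvec_index j k) =
    row i (matricization1 T) 0 (mxvec_index j k) by rewrite [RHS]mxE.
by rewrite rowK mxvecE mxE.
Qed.

Lemma matricization1_tucker p1 p2 p3 r1 r2 r3 (S : tensor R r1 r2 r3)
    (U1 : 'M[R]_(p1, r1)) (U2 : 'M[R]_(p2, r2)) (U3 : 'M[R]_(p3, r3)) :
  matricization1 (tucker S U1 U2 U3) =
  U1 *m matricization1 (mode_prod3 (mode_prod2 S U2) U3).
Proof.
apply/matrixP => i l; case/mxvec_indexP: l => j k.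
rewrite matricization1E tuckerE mxE; apply: eq_bigr => a _.
rewrite matricization1E /mode_prod3 mulr_sumr exchange_big; apply: eq_bigr => c _ /=.
rewrite /mode_prod2 mulr_suml mulr_sumr; apply: eq_bigr => b _.
by ring.
Qed.

Lemma orthonormal_isometry p r (U : 'M[R]_(p, r)) (f g : 'I_r -> R) :
  U^T *m U = 1%:M ->
  \sum_k (\sum_c f c * U k c) * (\sum_c g c * U k c) = \sum_c f c * g c.
Proof.
move=> UU.
pose F := \row_c f c; pose G := \row_c g c.
have rowU h k : \sum_c h c * U k c = ((\row_c h c) *m U^T) 0 k.
  by rewrite mxE; apply: eq_bigr => c _; rewrite !mxE.
transitivity ((F *m U^T *m (G *m U^T)^T) 0 0).
  by rewrite [RHS]mxE; apply: eq_bigr => k _; rewrite !rowU [(_^T) k 0]mxE.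
rewrite trmx_mul trmxK -mulmxA (mulmxA U^T) UU mul1mx mxE.
by apply: eq_bigr => c _; rewrite !mxE.
Qed.

(** Orthonormal factors in the other two modes preserve inner products of
    slices, so the singular values of this unfolding are those of the core. *)
Lemma gram_mode_prod p2 p3 r1 r2 r3 (S : tensor R r1 r2 r3)
    (U2 : 'M[R]_(p2, r2)) (U3 : 'M[R]_(p3, r3)) :
  U2^T *m U2 = 1%:M -> U3^T *m U3 = 1%:M ->
  let Q := matricization1 (mode_prod3 (mode_prod2 S U2) U3) in
  Q *m Q^T = matricization1 S *m (matricization1 S)^T.
Proof.
move=> UU2 UU3 /=; apply/matrixP => a a'; rewrite !mxE.
under eq_bigr do rewrite [(_^T) _ _]mxE.
under [RHS]eq_bigr do rewrite [(_^T) _ _]mxE.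
rewrite !sum_mxvec_index.
under eq_bigr => j _ do under eq_bigr => k _ do rewrite !matricization1E.
under [RHS]eq_bigr => j _ do under eq_bigr => k _ do rewrite !matricization1E.
under eq_bigr => j _ do rewrite (orthonormal_isometry _ _ UU3).
rewrite exchange_big [RHS]exchange_big; apply: eq_bigr => c _ /=.
exact: orthonormal_isometry.
Qed.

Lemma incoherent_le p r (G : 'M[R]_(p, r)) (mu : R) : G^T *m G = 1%:M -> 0 <= mu ->
  (forall m, \sum_a G m a ^+ 2 <= mu ^+ 2 * (r%:R / p%:R)) -> incoherent mu G.
Proof.
move=> GG mu0 GB; split=> //; apply: bigmax_le => [|m _].
  by rewrite mulr_ge0// sqrtr_ge0.
rewrite enorm_row -[X in X * _]ger0_norm// -sqrtr_sqr -sqrtrM ?sqr_ge0//.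
by rewrite ler_sqrt// mulr_ge0 ?sqr_ge0// divr_ge0.
Qed.

(** The frames of [perturb_left_factor] multiply [diag(L) V^T]; composing them
    with the transpose of the change of basis of [align_svd] turns them into
    factors for the same core [S], with rows of the same norms. *)
Lemma perturb_mode1 p1 p2 p3 r1 r2 r3 (S : tensor R r1 r2 r3)
    (U1 : 'M[R]_(p1, r1)) (U2 : 'M[R]_(p2, r2)) (U3 : 'M[R]_(p3, r3))
    (U : 'M[R]_(p1, r1)) (L : 'rV[R]_r1) (V : 'M[R]_(p2 * p3, r1))
    (lam tau : R) (i : 'I_p1) (j : 'I_p2) (k : 'I_p3) :
  (0 < r1)%N -> (2 * r1 <= p1)%N ->
  U1^T *m U1 = 1%:M -> U2^T *m U2 = 1%:M -> U3^T *m U3 = 1%:M ->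
  U^T *m U = 1%:M -> V^T *m V = 1%:M ->
  matricization1 (tucker S U1 U2 U3) = U *m diag_mx L *m V^T ->
  0 < lam -> (forall s, singular_values (matricization1 S) s -> lam <= s) ->
  0 <= tau -> tau <= lam -> tau ^+ 2 / lam ^+ 2 <= 4 * (r1%:R / p1%:R) ->
  exists F0 F1 : 'M[R]_(p1, r1),
    let T0 := tucker S F0 U2 U3 in let T1 := tucker S F1 U2 U3 in
    [/\ incoherent 2 F0, incoherent 2 F1,
        \sum_a \sum_b \sum_c (T1 a b c - T0 a b c) ^+ 2 <= tau ^+ 2
      & tau / 2 * enorm (row (mxvec_index j k) V) <= T1 i j k - T0 i j k].
Proof.
move=> r0 rp UU1 UU2 UU3 UU VV ME lam0 sv tau0 taul taub.
rewrite matricization1_tucker in ME.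
have [Or [OO QE lamL]] := align_svd UU1 UU VV ME (gram_mode_prod S UU2 UU3) lam0 sv.
have [G0 [G1 [[GG0 GG1 GB0 GB1] [dist sep]]]] :=
  perturb_left_factor i (mxvec_index j k) r0 rp VV lam0 lamL tau0 taul taub.
have inc (G : 'M[R]_(p1, r1)) : G^T *m G = 1%:M -> (forall m, \sum_a G m a ^+ 2 <= 4 * (r1%:R / p1%:R)) ->
    incoherent 2 (G *m Or^T).
  move=> GG GB; apply: incoherent_le => // [|m].
    by rewrite trmx_mul trmxK mulmxA -(mulmxA Or) GG mulmx1.
  have -> : \sum_a (G *m Or^T) m a ^+ 2 = \sum_a G m a ^+ 2.
    transitivity (\sum_a row m (G *m Or^T) 0 a ^+ 2).
      by apply: eq_bigr => a _; rewrite [in RHS]mxE.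
    rewrite sum_sqr_rv row_mul trmx_mul trmxK mulmxA -(mulmxA (row m G)).
    rewrite (mulmx1C OO) mulmx1 -sum_sqr_rv.
    by apply: eq_bigr => a _; rewrite mxE.
  by apply: le_trans (GB m) _; have -> : 2 ^+ 2 = 4 :> R by ring.
have mat (G : 'M[R]_(p1, r1)) : matricization1 (tucker S (G *m Or^T) U2 U3) = G *m diag_mx L *m V^T.
  by rewrite matricization1_tucker QE !mulmxA -(mulmxA G) (mulmx1C OO) mulmx1.
have diffE a b c : tucker S (G1 *m Or^T) U2 U3 a b c - tucker S (G0 *m Or^T) U2 U3 a b c =
    ((G1 - G0) *m diag_mx L *m V^T) a (mxvec_index b c).
  by rewrite -!matricization1E !mat !mulmxBl !mxE.
exists (G0 *m Or^T), (G1 *m Or^T) => /=; split.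
- exact: inc.
- exact: inc.
- rewrite (le_trans _ dist)// le_eqVlt; apply/orP; left; apply/eqP.
  apply: eq_bigr => a _; rewrite sum_mxvec_index.
  by apply: eq_bigr => b _; apply: eq_bigr => c _; rewrite diffE.
- by rewrite diffE.
Qed.

End TensorPerturbation.

Section Family.
Context {R : realType}.

(** Fixing the core makes the conditions on singular values automatic; the
    lower bound is proved within such a family. *)
Definition with_core {p1 p2 p3 r1 r2 r3} (mu : R) (S : tensor R r1 r2 r3) :
    set (tensor R p1 p2 p3) :=
  [set T | exists (U1 : 'M[R]_(p1, r1)) (U2 : 'M[R]_(p2, r2)) (U3 : 'M[R]_(p3, r3)),
    T = tucker S U1 U2 U3 /\ [/\ incoherent mu U1, incoherent mu U2 & incoherent mu U3]].

Lemma incoherent_mono p r (mu mu' : R) (U : 'M[R]_(p, r)) :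
  mu <= mu' -> incoherent mu U -> incoherent mu' U.
Proof.
by move=> le_mu [UU UB]; split=> //; rewrite (le_trans UB)// ler_wpM2r// sqrtr_ge0.
Qed.

Lemma with_core_rot p1 p2 p3 r1 r2 r3 (mu : R) (S : tensor R r1 r2 r3)
    (T : tensor R p1 p2 p3) :
  with_core mu S T -> with_core mu (rot S) (rot T).
Proof.
move=> [U1 [U2 [U3 [-> [i1 i2 i3]]]]]; exists U2, U3, U1; split; last by split.
exact: rot_tucker.
Qed.

(** The unfoldings of a rotated tensor are those of the tensor, in another
    order. *)
Lemma tensor_singular_values_rot r1 r2 r3 (S : tensor R r1 r2 r3) (s : R) :
  tensor_singular_values (rot S) s -> tensor_singular_values S s.
Proof. by case=> [[]|]; [left; right|right|left; left]. Qed.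

(** What the two-point argument needs from [A]: [tau] limits how well the data
    distinguish the two tensors, and [v] is the row norm to appear in the lower
    bound. *)
Definition separated {p1 p2 p3} (A : set (tensor R p1 p2 p3)) (tau v : R)
    (i : 'I_p1) (j : 'I_p2) (k : 'I_p3) : Prop :=
  exists T0 T1, [/\ A T0, A T1,
    \sum_a \sum_b \sum_c (T1 a b c - T0 a b c) ^+ 2 <= tau ^+ 2
    & tau / 2 * v <= T1 i j k - T0 i j k].

Lemma separated_mode1 p1 p2 p3 r1 r2 r3 (mu : R) (S : tensor R r1 r2 r3)
    (T : tensor R p1 p2 p3) (U : 'M[R]_(p1, r1)) (L : 'rV[R]_r1)
    (V : 'M[R]_(p2 * p3, r1)) (lam tau : R) (i : 'I_p1) (j : 'I_p2) (k : 'I_p3) :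
  with_core mu S T -> 2 <= mu -> (0 < r1)%N -> (2 * r1 <= p1)%N ->
  U^T *m U = 1%:M -> V^T *m V = 1%:M -> matricization1 T = U *m diag_mx L *m V^T ->
  0 < lam -> (forall s, tensor_singular_values S s -> lam <= s) ->
  0 <= tau -> tau ^+ 2 * p1%:R <= lam ^+ 2 ->
  separated (with_core mu S) tau (enorm (row (mxvec_index j k) V)) i j k.
Proof.
move=> [U1 [U2 [U3 [-> [i1 i2 i3]]]]] mu2 r0 rp UU VV ME lam0 sv tau0 taul.
have p0 : 1 <= p1%:R :> R by rewrite ler1n; lia.
have taup : tau ^+ 2 / lam ^+ 2 <= p1%:R^-1.
  by rewrite ler_pdivrMr ?exprn_gt0// mulrC ler_pdivlMr ?(lt_le_trans ltr01).
have taub : tau ^+ 2 / lam ^+ 2 <= 4 * (r1%:R / p1%:R).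
  apply: le_trans taup _; rewrite mulrA ler_peMl ?invr_ge0 ?ler0n//.
  by have : 1 <= r1%:R :> R; [rewrite ler1n | lra].
have tau_lam : tau <= lam.
  have : tau ^+ 2 <= lam ^+ 2.
    by apply: le_trans taul; rewrite ler_peMr// sqr_ge0.
  by rewrite ler_pXn2r ?nnegrE ?(ltW lam0)//.
have [F0 [F1 /= [h0 h1 dist sep]]] := perturb_mode1 i j k r0 rp i1.1 i2.1 i3.1 UU VV ME
  lam0 (fun s hs => sv s (or_introl (or_introl hs))) tau0 tau_lam taub.
exists (tucker S F0 U2 U3), (tucker S F1 U2 U3); split => //.
  by exists F0, U2, U3; split => //; split => //; exact: incoherent_mono h0.
by exists F1, U2, U3; split => //; split => //; exact: incoherent_mono h1.
Qed.

(** Three rotations compose to the identity, so a pair found for the rotated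
    core is brought back by two more. *)
Lemma separated_rot p1 p2 p3 r1 r2 r3 (mu : R) (S : tensor R r1 r2 r3) (tau v : R)
    (i : 'I_p1) (j : 'I_p2) (k : 'I_p3) :
  separated (with_core mu (rot S)) tau v j k i -> separated (with_core mu S) tau v i j k.
Proof.
move=> [T0 [T1 [h0 h1 dist sep]]]; exists (rot (rot T0)), (rot (rot T1)); split.
- exact: (with_core_rot (with_core_rot h0)).
- exact: (with_core_rot (with_core_rot h1)).
- apply: le_trans dist; rewrite exchange_big le_eqVlt; apply/orP; left; apply/eqP.
  by apply: eq_bigr => b _; rewrite exchange_big.
- exact: sep.
Qed.

Lemma separated_mode2 p1 p2 p3 r1 r2 r3 (mu : R) (S : tensor R r1 r2 r3)
    (T : tensor R p1 p2 p3) (U : 'M[R]_(p2, r2)) (L : 'rV[R]_r2)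
    (V : 'M[R]_(p3 * p1, r2)) (lam tau : R) (i : 'I_p1) (j : 'I_p2) (k : 'I_p3) :
  with_core mu S T -> 2 <= mu -> (0 < r2)%N -> (2 * r2 <= p2)%N ->
  U^T *m U = 1%:M -> V^T *m V = 1%:M -> matricization2 T = U *m diag_mx L *m V^T ->
  0 < lam -> (forall s, tensor_singular_values S s -> lam <= s) ->
  0 <= tau -> tau ^+ 2 * p2%:R <= lam ^+ 2 ->
  separated (with_core mu S) tau (enorm (row (mxvec_index k i) V)) i j k.
Proof.
move=> hT mu2 r0 rp UU VV ME lam0 sv tau0 taul; apply: separated_rot.
apply: (separated_mode1 j k i (with_core_rot hT) mu2 r0 rp UU VV ME lam0) => // s hs.
exact/sv/tensor_singular_values_rot.
Qed.

Lemma separated_mode3 p1 p2 p3 r1 r2 r3 (mu : R) (S : tensor R r1 r2 r3)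
    (T : tensor R p1 p2 p3) (U : 'M[R]_(p3, r3)) (L : 'rV[R]_r3)
    (V : 'M[R]_(p1 * p2, r3)) (lam tau : R) (i : 'I_p1) (j : 'I_p2) (k : 'I_p3) :
  with_core mu S T -> 2 <= mu -> (0 < r3)%N -> (2 * r3 <= p3)%N ->
  U^T *m U = 1%:M -> V^T *m V = 1%:M -> matricization3 T = U *m diag_mx L *m V^T ->
  0 < lam -> (forall s, tensor_singular_values S s -> lam <= s) ->
  0 <= tau -> tau ^+ 2 * p3%:R <= lam ^+ 2 ->
  separated (with_core mu S) tau (enorm (row (mxvec_index i j) V)) i j k.
Proof.
move=> hT mu2 r0 rp UU VV ME lam0 sv tau0 taul; apply: separated_rot.
apply: (@separated_mode2 _ _ _ _ _ _ mu _ _ U L V lam tau j k i (with_core_rot hT) mu2 r0 rp UU VV ME lam0) => // s hs.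
exact/sv/tensor_singular_values_rot.
Qed.

(** The unit vector with constant entries, the frame used when some mode has
    length one and hence all ranks are one. *)
Definition flat_frame p : 'M[R]_(p, 1) := const_mx (Num.sqrt p%:R)^-1.

Lemma flat_frame_orth p : (0 < p)%N -> (flat_frame p)^T *m flat_frame p = 1%:M.
Proof.
move=> p0; apply/matrixP => a b; rewrite !ord1 !mxE eqxx.
under eq_bigr do rewrite !mxE -invfM -expr2 sqr_sqrtr ?ler0n//.
by rewrite sumr_const card_ord -[_ *+ _]mulr_natr mulVf// pnatr_eq0 -lt0n.
Qed.

Lemma flat_frame_incoherent p (mu : R) : (0 < p)%N -> 1 <= mu ->
  incoherent mu (flat_frame p).
Proof.
move=> p0 mu1; apply: incoherent_le => [||m]; first exact: flat_frame_orth.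
  exact: le_trans mu1.
rewrite big_ord1 mxE exprVn sqr_sqrtr ?ler0n// mul1r.
by rewrite ler_peMl ?invr_ge0 ?ler0n// expr_ge1// (le_trans _ mu1).
Qed.

Lemma enorm_row_flat_frame p (l : 'I_p) :
  enorm (row l (flat_frame p)) = (Num.sqrt p%:R)^-1.
Proof. by rewrite enorm_row big_ord1 mxE sqrtr_sqr ger0_norm// invr_ge0 sqrtr_ge0. Qed.

Lemma matricization1_flat p1 p2 p3 (S : tensor R 1 1 1) :
  matricization1 (tucker S (flat_frame p1) (flat_frame p2) (flat_frame p3)) =
  flat_frame p1 *m diag_mx (const_mx (S 0 0 0)) *m (flat_frame (p2 * p3))^T.
Proof.
apply/matrixP => i l; case/mxvec_indexP: l => j k.
rewrite matricization1E tuckerE !big_ord1 mul_mx_diag [RHS]mxE big_ord1 !mxE.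
rewrite natrM sqrtrM ?ler0n// invfM.
by rewrite mulrA [X in X * _ * _]mulrC.
Qed.

(** The case of a constant signal, for which the row norms are explicit and
    depend only on the lengths of the modes; modes 2 and 3 may have length
    one. *)
Lemma separated_flat_mode1 p1 p2 p3 (mu : R) (S : tensor R 1 1 1) (lam tau : R)
    (i : 'I_p1) (j : 'I_p2) (k : 'I_p3) :
  2 <= mu -> (1 < p1)%N -> 0 < lam ->
  (forall s, tensor_singular_values S s -> lam <= s) ->
  0 <= tau -> tau ^+ 2 * p1%:R <= lam ^+ 2 ->
  separated (with_core mu S) tau (Num.sqrt (p2 * p3)%:R)^-1 i j k.
Proof.
move=> mu2 p11 lam0 sv tau0 taul.
have p10 := ltnW p11.
have p20 : (0 < p2)%N by apply: leq_ltn_trans (ltn_ord j).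
have p30 : (0 < p3)%N by apply: leq_ltn_trans (ltn_ord k).
have mu1 : 1 <= mu by lra.
rewrite -(enorm_row_flat_frame (mxvec_index j k)).
apply: (separated_mode1 i j k _ mu2 _ _ _ _ (matricization1_flat p1 p2 p3 S) lam0) => //.
- exists (flat_frame p1), (flat_frame p2), (flat_frame p3).
  by split => //; split; exact: flat_frame_incoherent.
- exact: flat_frame_orth.
- by apply: flat_frame_orth; rewrite muln_gt0 p20.
Qed.

End Family.

(** * The minimax lower bound *)

Section LowerBound.
Context {R : realType} {p1 p2 p3 : nat}.
Context {d : measure_display} {Omega : measurableType d}.
Variables (P : probability Omega R) (Z : 'I_p1 -> 'I_p2 -> 'I_p3 -> {RV P >-> R}).
Variables (sd : tensor R p1 p2 p3) (sigma_min : R).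
Hypotheses (sigma_min_gt0 : 0 < sigma_min) (sd_ge : forall a b c, sigma_min <= sd a b c).
Hypothesis Z_gaussian : gaussian_noise sd Z.

(** With [4 * a = 1 - 2 * alpha], the probability [1 - 2 * alpha - 2 * a] of
    covering both entries is [2 * a]. *)
Lemma minimax_of_separated (A Th : set (tensor R p1 p2 p3)) (alpha a eps v len : R)
    (i : 'I_p1) (j : 'I_p2) (k : 'I_p3) :
  A `<=` Th -> 0 < a -> 4 * a = 1 - 2 * alpha -> expR (eps ^+ 2) <= 1 + 4 * a ^+ 2 ->
  separated A (eps * sigma_min) v i j k -> len <= a * eps * sigma_min * v ->
  (len%:E <= minimax_length Z Th alpha i j k)%E.
Proof.
move=> AT a0 aE epsB [T0 [T1 [A0 A1 dist sep]]] lenB.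
have sd0 x : 0 < entry sd x by apply: lt_le_trans (sd_ge _ _ _).
apply: (minimax_two_point (a := a) _ Z_gaussian (AT _ A0) (AT _ A1) a0).
- by move=> x y z; rewrite gt_eqF// (sd0 (x, y, z)).
- apply: le_trans epsB; rewrite ler_expR.
  have : \sum_x shift T0 T1 x ^+ 2 / entry sd x ^+ 2 <=
      \sum_x shift T0 T1 x ^+ 2 / sigma_min ^+ 2.
    apply: ler_sum => x _; rewrite ler_wpM2l ?sqr_ge0//.
    rewrite lef_pV2 ?posrE ?exprn_gt0//.
    by rewrite ler_pXn2r ?nnegrE ?sd_ge// ltW.
  move=> /le_trans; apply; rewrite -mulr_suml ler_pdivrMr ?exprn_gt0// -exprMn.
  by move: dist; rewrite !pair_bigA.
- rewrite (_ : 1 - 2 * alpha - 2 * a = 2 * a); last lra.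
  apply: (le_trans lenB).
  have : 2 * a * (eps * sigma_min / 2 * v) <= 2 * a * `|T1 i j k - T0 i j k|.
    by rewrite ler_wpM2l ?(le_trans sep) ?ler_norm// mulr_ge0// ltW.
  by apply: le_trans; rewrite le_eqVlt; apply/orP; left; apply/eqP; field.
Qed.

End LowerBound.

Section Ranks.
Implicit Types p r : nat.

Lemma leq_max3 p1 p2 p3 :
  [/\ (p1 <= max3 p1 p2 p3)%N, (p2 <= max3 p1 p2 p3)%N & (p3 <= max3 p1 p2 p3)%N].
Proof. by rewrite /max3; split; lia. Qed.

Lemma geq_min3 p1 p2 p3 :
  [/\ (min3 p1 p2 p3 <= p1)%N, (min3 p1 p2 p3 <= p2)%N & (min3 p1 p2 p3 <= p3)%N].
Proof. by rewrite /min3; split; lia. Qed.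

Lemma double_le_of_sqr_le r p : (1 < p)%N -> (r ^ 2 <= p)%N -> (2 * r <= p)%N.
Proof. by case: r => [|[|r]]; rewrite ?expnS ?expn0; nia. Qed.

Lemma min3_gt0 p1 p2 p3 : (0 < min3 p1 p2 p3)%N = [&& 0 < p1, 0 < p2 & 0 < p3]%N.
Proof. by rewrite /min3 !leq_min. Qed.

End Ranks.

Section Bounds.
Context {R : realType}.

Lemma sqrt_sum3_le (x y z : R) : 0 <= x -> 0 <= y -> 0 <= z ->
  [\/ Num.sqrt (x ^+ 2 + y ^+ 2 + z ^+ 2) <= 2 * x,
      Num.sqrt (x ^+ 2 + y ^+ 2 + z ^+ 2) <= 2 * y
    | Num.sqrt (x ^+ 2 + y ^+ 2 + z ^+ 2) <= 2 * z].
Proof.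
have max_le (s t u : R) : 0 <= t -> 0 <= u -> t <= s -> u <= s ->
    Num.sqrt (s ^+ 2 + t ^+ 2 + u ^+ 2) <= 2 * s.
  move=> t0 u0 ts us; have s0 := le_trans t0 ts.
  rewrite -[leRHS]ger0_norm ?mulr_ge0// -sqrtr_sqr ler_wsqrtr//.
  have -> : (2 * s) ^+ 2 = 4 * s ^+ 2 by ring.
  have : t ^+ 2 <= s ^+ 2 by rewrite ler_pXn2r.
  have : u ^+ 2 <= s ^+ 2 by rewrite ler_pXn2r.
  by have := sqr_ge0 s; lra.
move=> x0 y0 z0; have [xy|/ltW yx] := leP x y.
  have [yz|/ltW zy] := leP y z.
    by constructor 3; rewrite addrC addrA max_le// (le_trans xy).
  by constructor 2; rewrite (addrC (x ^+ 2)) max_le.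
have [xz|/ltW zx] := leP x z; last by constructor 1; rewrite max_le.
by constructor 3; rewrite addrC addrA max_le// (le_trans yx).
Qed.

Lemma enorm_row_le1 n (V : 'M[R]_(n, 1)) l : V^T *m V = 1%:M ->
  enorm (row l V) ^+ 2 <= 1.
Proof.
move=> VV; rewrite enorm_row sqr_sqrtr ?sumr_ge0// => [|a _]; last exact: sqr_ge0.
have <- : \sum_m V m 0 ^+ 2 = 1 by rewrite sum_sqr_cv VV mxE eqxx.
rewrite big_ord1 (bigD1 l)//= lerDl sumr_ge0// => m _; exact: sqr_ge0.
Qed.

End Bounds.

Theorem theorem9 (R : realType) (C C0 alpha : R)
    (hC : 0 < C) (hC0 : 0 < C0) (halpha : 0 < alpha < 2^-1) :
  exists2 c : R, 0 < c &
    forall (p1 p2 p3 r1 r2 r3 : nat)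
      (lambda kappa mu0 sigma sigma_min : R) (sd : tensor R p1 p2 p3)
      (d : measure_display) (Omega : measurableType d)
      (P : probability Omega R)
      (Z : 'I_p1 -> 'I_p2 -> 'I_p3 -> {RV P >-> R})
      (i : 'I_p1) (j : 'I_p2) (k : 'I_p3),
    let pmin := min3 p1 p2 p3 in
    let rmin := min3 r1 r2 r3 in
    let rmax := max3 r1 r2 r3 in
    let Th := Theta r1 r2 r3 C0 sd lambda kappa mu0 sigma sigma_min in
    (1 < p1 * p2 * p3)%N ->
    (0 < rmin)%N ->
    0 < lambda -> 0 < sigma -> 2 < mu0 ->
    rmax%:R <= C * rmin%:R ->
    [/\ p1%:R <= C * pmin%:R, p2%:R <= C * pmin%:R & p3%:R <= C * pmin%:R] ->
    sigma <= C * sigma_min ->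
    gaussian_noise sd Z ->
    forall (T : tensor R p1 p2 p3)
      (U1 : 'M[R]_(p1, r1)) (L1 : 'rV[R]_r1) (V1 : 'M[R]_(p2 * p3, r1))
      (U2 : 'M[R]_(p2, r2)) (L2 : 'rV[R]_r2) (V2 : 'M[R]_(p3 * p1, r2))
      (U3 : 'M[R]_(p3, r3)) (L3 : 'rV[R]_r3) (V3 : 'M[R]_(p1 * p2, r3)),
    Th T ->
    rank_svd (matricization1 T) U1 L1 V1 ->
    rank_svd (matricization2 T) U2 L2 V2 ->
    rank_svd (matricization3 T) U3 L3 V3 ->
    ((c * sigma_min *
        Num.sqrt (enorm (row (mxvec_index j k) V1) ^+ 2
                  + enorm (row (mxvec_index k i) V2) ^+ 2
                  + enorm (row (mxvec_index i j) V3) ^+ 2))%:E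
     <= minimax_length Z Th alpha i j k)%E.
Proof.
case/andP: halpha => alpha0 alpha1.
(* Half of the slack [1 - 2 * alpha] is spent on the change of measure. *)
pose a := (1 - 2 * alpha) / 4.
have a0 : 0 < a by rewrite /a; lra.
have aE : 4 * a = 1 - 2 * alpha by rewrite /a; lra.
have a2 : 0 < a ^+ 2 by rewrite exprn_gt0.
(* The logarithm makes the second moment of the likelihood ratio at most
   [1 + 4 * a ^+ 2]; the bound by [C0] keeps the angle of rotation small. *)
pose eps := Num.min C0 (Num.sqrt (ln (1 + 4 * a ^+ 2))).
have ln0 : 0 < ln (1 + 4 * a ^+ 2) by rewrite ln_gt0//; lra.
have eps0 : 0 < eps by rewrite lt_min hC0 sqrtr_gt0.
have epsC : eps <= C0 by rewrite ge_min lexx.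
have epsB : expR (eps ^+ 2) <= 1 + 4 * a ^+ 2.
  rewrite -[leRHS]lnK ?posrE; last lra.
  rewrite ler_expR -[leRHS]sqr_sqrtr ?(ltW ln0)//.
  by rewrite ler_pXn2r ?nnegrE ?(ltW eps0) ?sqrtr_ge0// ge_min lexx orbT.
have min0 : 0 < Num.min 1 C^-1 by rewrite lt_min ltr01 invr_gt0.
(* The factor [C^-1] is a lower bound for row norms in the rank-one case. *)
exists (a * eps / 2 * Num.min 1 C^-1); first by do 2 apply: mulr_gt0 => //; apply: mulr_gt0.
move=> p1 p2 p3 r1 r2 r3 lambda kappa mu0 sigma sigma_min sd d Omega P Z i j k /=.
move=> pprod rmin0 lambda0 sigma0 mu02 _ [pC1 pC2 pC3] sigmaC Zg.
move=> T U1 L1 V1 U2 L2 V2 U3 L3 V3 ThT [UU1 VV1 _ ME1] [UU2 VV2 _ ME2] [UU3 VV3 _ ME3].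
have [[S [W1 [W2 [W3 [TE [inc1 inc2 inc3] [lam1 [lam2 lam3]]]]]]] [snr sdb kap rk]] := ThT.
set Th := Theta _ _ _ _ _ _ _ _ _ _.
have ATh : with_core mu0 S `<=` Th.
  move=> _ [F1 [F2 [F3 [-> [f1 f2 f3]]]]]; split => //.
  by exists S, F1, F2, F3; split.
have AT : with_core mu0 S T by exists W1, W2, W3.
have sv s : tensor_singular_values S s -> lambda <= s.
  move=> hs; apply: (le_trans lam1); apply: ge_inf => //.
  by exists 0 => t [[]|] [].
have sm0 : 0 < sigma_min.
  by rewrite -(pmulr_rgt0 _ hC); exact: lt_le_trans sigmaC.
have sm_le : sigma_min <= sigma by case/andP: (sdb i j k) => /le_trans; apply.
have sd_ge x y z : sigma_min <= sd x y z by case/andP: (sdb x y z).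
have kap1 : 1 <= kappa.
  by rewrite -(ler_pM2r lambda0) mul1r (le_trans lam1)// (le_trans lam2).
pose tau := eps * sigma_min.
have tau0 : 0 <= tau by rewrite mulr_ge0// ltW.
have rmax1 : (1 <= max3 r1 r2 r3)%N.
  have [r1_le _ _] := leq_max3 r1 r2 r3; apply: leq_trans r1_le.
  by move: rmin0; rewrite min3_gt0 => /and3P[].
have tau_max : tau ^+ 2 * (max3 p1 p2 p3)%:R <= lambda ^+ 2.
  set X := (max3 p1 p2 p3)%:R : R.
  have X0 : 0 <= Num.sqrt X by exact: sqrtr_ge0.
  have kr1 : 1 <= kappa * (max3 r1 r2 r3)%:R.
    by rewrite mulr_ege1// ler1n.
  have CX : C0 * Num.sqrt X * sigma <= lambda.
    rewrite -ler_pdivlMr//; apply: le_trans snr; rewrite ler_wpM2r//.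
    by rewrite -mulrA ler_peMr// ltW.
  have tX : tau * Num.sqrt X <= lambda.
    apply: le_trans CX; rewrite [leRHS]mulrAC ler_wpM2r// /tau.
    by rewrite ler_pM// ltW.
  rewrite -[X in _ * X]sqr_sqrtr ?ler0n// -exprMn.
  by rewrite ler_pXn2r ?nnegrE ?(ltW lambda0)// mulr_ge0.
have tau_le p : (p <= max3 p1 p2 p3)%N -> tau ^+ 2 * p%:R <= lambda ^+ 2.
  by move=> pm; apply: le_trans tau_max; rewrite ler_wpM2l ?sqr_ge0// ler_nat.
have [tau1 tau2 tau3] : [/\ tau ^+ 2 * p1%:R <= lambda ^+ 2,
    tau ^+ 2 * p2%:R <= lambda ^+ 2 & tau ^+ 2 * p3%:R <= lambda ^+ 2].
  by have [? ? ?] := leq_max3 p1 p2 p3; split; exact: tau_le.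
have rk2 : (max3 r1 r2 r3 ^ 2 <= min3 p1 p2 p3)%N.
  rewrite -(ler_nat R) natrX -[leRHS]sqr_sqrtr ?ler0n//.
  by rewrite ler_pXn2r ?nnegrE ?ler0n ?sqrtr_ge0// -powR12_sqrt ?ler0n.
(* One separated pair suffices, when its [v] is at least half of the norm
   [rows] to be bounded, up to the factor [Num.min 1 C^-1]. *)
set c := a * eps / 2 * _; set rows := Num.sqrt _.
have fin v : separated (with_core mu0 S) tau v i j k ->
    Num.min 1 C^-1 * rows <= 2 * v ->
    ((c * sigma_min * rows)%:E <= minimax_length Z Th alpha i j k)%E.
  move=> sep rows_v; apply: (minimax_of_separated sm0 sd_ge Zg ATh a0 aE epsB sep).
  have -> : c * sigma_min * rows = a * eps * sigma_min / 2 * (Num.min 1 C^-1 * rows).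
    by rewrite /c; field.
  have -> : a * eps * sigma_min * v = a * eps * sigma_min / 2 * (2 * v) by field.
  by rewrite ler_wpM2l// ltW// divr_gt0// mulr_gt0// mulr_gt0.
have mu02' := ltW mu02.
have rows0 : 0 <= rows by exact: sqrtr_ge0.
have e0 n (v : 'rV[R]_n) : 0 <= enorm v by exact: sqrtr_ge0.
have [r1m r2m r3m] := leq_max3 r1 r2 r3.
have [p1m p2m p3m] := geq_min3 p1 p2 p3.
move: (rmin0); rewrite min3_gt0 => /and3P[r10 r20 r30].
have sqr_le r p : (r <= max3 r1 r2 r3)%N -> (min3 p1 p2 p3 <= p)%N -> (r ^ 2 <= p)%N.
  by move=> rm pm; rewrite (leq_trans _ pm)// (leq_trans _ rk2)// leq_exp2r.
have [pmin2|pmin1] := leqP 2 (min3 p1 p2 p3).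
  have double r p : (r <= max3 r1 r2 r3)%N -> (min3 p1 p2 p3 <= p)%N -> (2 * r <= p)%N.
    move=> rm pm; apply: double_le_of_sqr_le; first exact: leq_trans pm.
    exact: sqr_le.
  have minle : Num.min 1 C^-1 * rows <= rows.
    by rewrite ler_piMl// ge_min lexx.
  have [h|h|h] := sqrt_sum3_le (e0 _ (row (mxvec_index j k) V1))
      (e0 _ (row (mxvec_index k i) V2)) (e0 _ (row (mxvec_index i j) V3)).
  - apply: (fin _ _ (le_trans minle h)).
    exact: (separated_mode1 i j k AT mu02' r10 (double _ _ r1m p1m) UU1 VV1 ME1 lambda0 sv tau0 tau1).
  - apply: (fin _ _ (le_trans minle h)).
    exact: (separated_mode2 i j k AT mu02' r20 (double _ _ r2m p2m) UU2 VV2 ME2 lambda0 sv tau0 tau2).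
  - apply: (fin _ _ (le_trans minle h)).
    exact: (separated_mode3 i j k AT mu02' r30 (double _ _ r3m p3m) UU3 VV3 ME3 lambda0 sv tau0 tau3).
have p1n : (0 < p1)%N by apply: leq_ltn_trans (ltn_ord i).
have p2n : (0 < p2)%N by apply: leq_ltn_trans (ltn_ord j).
have p3n : (0 < p3)%N by apply: leq_ltn_trans (ltn_ord k).
(* Some mode has length one: all ranks are one and all lengths are at most C. *)
have pE : min3 p1 p2 p3 = 1%N.
  by apply/eqP; rewrite eqn_leq -ltnS pmin1 min3_gt0 p1n p2n.
have rank1 r : (0 < r)%N -> (r <= max3 r1 r2 r3)%N -> r = 1%N.
  move=> rp rm; apply/eqP; rewrite eqn_leq rp andbT -(@leq_exp2r _ _ 2)//.
  by rewrite exp1n (leq_trans _ (leq_trans rk2 _)) ?pE// leq_exp2r.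
have r1E := rank1 _ r10 r1m; have r2E := rank1 _ r20 r2m; have r3E := rank1 _ r30 r3m.
move: pC1 pC2 pC3; rewrite pE mulr1 => pC1 pC2 pC3.
subst r1 r2 r3.
have rows2 : rows <= 2.
  rewrite /rows -[leRHS]ger0_norm// -sqrtr_sqr ler_wsqrtr//.
  have := enorm_row_le1 (mxvec_index j k) VV1; have := enorm_row_le1 (mxvec_index k i) VV2.
  have := enorm_row_le1 (mxvec_index i j) VV3.
  have -> : 2 ^+ 2 = 4 :> R by ring.
  by lra.
have flat p q : (0 < p)%N -> (0 < q)%N -> p%:R <= C -> q%:R <= C ->
    Num.min 1 C^-1 * rows <= 2 * (Num.sqrt (p * q)%:R)^-1.
  move=> p_gt0 q_gt0 pC qC.
  have sq0 : 0 < Num.sqrt (p * q)%:R :> R by rewrite sqrtr_gt0 ltr0n muln_gt0 p_gt0.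
  have sqC : Num.sqrt (p * q)%:R <= C.
    rewrite -[leRHS]ger0_norm ?(ltW hC)// -sqrtr_sqr ler_wsqrtr// natrM expr2.
    by rewrite ler_pM.
  rewrite mulrC ler_pM ?(ltW min0)//.
  by rewrite ge_min lef_pV2 ?posrE// sqC orbT.
have [p1_gt1|p1_le1] := ltnP 1 p1.
  apply: (fin _ _ (flat p2 p3 p2n p3n pC2 pC3)).
  exact: (separated_flat_mode1 i j k mu02' p1_gt1 lambda0 sv tau0 tau1).
have sv2 s : tensor_singular_values (rot S) s -> lambda <= s.
  by move=> /tensor_singular_values_rot; exact: sv.
have [p2_gt1|p2_le1] := ltnP 1 p2.
  apply: (fin _ _ (flat p3 p1 p3n p1n pC3 pC1)); apply: separated_rot.
  exact: (separated_flat_mode1 j k i mu02' p2_gt1 lambda0 sv2 tau0 tau2).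
have [p3_gt1|p3_le1] := ltnP 1 p3.
  apply: (fin _ _ (flat p1 p2 p1n p2n pC1 pC2)); do 2 apply: separated_rot.
  apply: (separated_flat_mode1 k i j mu02' p3_gt1 lambda0 _ tau0 tau3) => s.
  by move=> /tensor_singular_values_rot; exact: sv2.
have : (p1 * p2 * p3 <= 1)%N by exact: leq_mul (leq_mul p1_le1 p2_le1) p3_le1.
by rewrite leqNgt pprod.
Qed.
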